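(* Let $\mathbf m_1^{\mathrm{ini}},\dots,\mathbf m_4^{\mathrm{ini}}\in\mathbb R^3$ be the initial positions of four microphones mounted on a ground-based vehicle, and assume these four points do not lie on a common plane. Let $\mathbf L\in\mathbb R^3$ be the fixed position of a loudspeaker, and let $\mathcal W$ be a set of $n$ walls at fixed positions in $\mathbb R^3$. The set of vehicle positions is the group $\mathrm{ASO}(2)$ of dimension $3$ described in the context, i.e. the vehicle can move on the ground plane (rotations and translations in the $x$-$y$-plane). (i) If the microphones are not deceived by an unlucky stack of mirror points, then almost all vehicle positions are good; that is, the set of vehicle positions $\phi\in\mathrm{ASO}(2)$ that are not good is contained in a subvariety of $\mathrm{ASO}(2)$ of dimension strictly less than $3=\dim \mathrm{ASO}(2)$. (ii) Moreover, let $l\in\{2,3,4\}$ be the number of distinct $z$-coordinates of the four microphone positions. Then within the $(3n)$-dimensional configuration space of all arrangements of $n$ walls (with $\mathbf L$ and the microphone configuration fixed), the arrangements for which an unlucky stack of mirror points occurs are contained in a subvariety of codimension $3(l-1)$ (for $n<l$ this is read as saying that no such arrangement exists).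
   Context: **Vehicle positions.** $\mathrm{ASO}(2)$ is the group of all maps $\phi:\mathbb R^3\to\mathbb R^3$ of the form $$\phi(v)=\begin{pmatrix} a_{1,1}&a_{1,2}&0\\ a_{2,1}&a_{2,2}&0\\ 0&0&1\end{pmatrix}v+\begin{pmatrix} a_{1,3}\\ a_{2,3}\\ 0\end{pmatrix},\qquad a_{i,j}\in\mathbb R,$$ with $\begin{pmatrix} a_{1,1}&a_{1,2}\\ a_{2,1}&a_{2,2}\end{pmatrix}$ orthogonal of determinant $1$. It is regarded as an affine variety in $\mathbb R^6$ via the coordinates $a_{i,j}$. In the vehicle position $\phi$ the microphones are at $\mathbf m_i=\phi(\mathbf m_i^{\mathrm{ini}})$, $i=1,\dots,4$. **Walls and mirror points.** A wall is a plane surface, identified with the plane in $\mathbb R^3$ containing it. For a wall $W$, its mirror point is $\mathrm{ref}_W(\mathbf L)$, the reflection of $\mathbf L$ at the plane $W$. Walls are identified through their mirror points (a point $\mathbf s\neq\mathbf L$ is the mirror point of exactly one plane). The configuration space of arrangements of $n$ walls is the space of $n$-tuples of mirror points, viewed in $(\mathbb R^3)^n$. **Echoes.** Only first-order echoes are considered, ray acoustics is used, and all measurements are exact. For a vehicle position $\phi$ and $i\in\{1,\dots,4\}$, let $\mathcal H_i(\phi)\subseteq\mathcal W$ be the set of walls whose first-order echo is heard by microphone $i$; these sets are arbitrary. The echo of $W$ travels the distance $\lVert\mathrm{ref}_W(\mathbf L)-\mathbf m_i\rVert$ to microphone $i$, so the measured data are the sets $$\mathcal D_i=\{\lVert\mathrm{ref}_W(\mathbf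 L)-\mathbf m_i\rVert^2 : W\in\mathcal H_i(\phi)\},\quad i=1,\dots,4,$$ without information on which wall a value comes from. **Wall detection algorithm.** Let $D_{i,j}=\lVert\mathbf m_i-\mathbf m_j\rVert^2$ and define $$f_D(u_1,\dots,u_4)=\det\begin{pmatrix}0&u_1&\cdots&u_4&1\\ u_1&D_{1,1}&\cdots&D_{1,4}&1\\ \vdots&\vdots&&\vdots&\vdots\\ u_4&D_{4,1}&\cdots&D_{4,4}&1\\ 1&1&\cdots&1&0\end{pmatrix}.$$ For every $(d_1,\dots,d_4)\in\mathcal D_1\times\cdots\times\mathcal D_4$ with $f_D(d_1,\dots,d_4)=0$, the algorithm outputs the wall whose mirror point is the unique point $\mathbf s\in\mathbb R^3$ with $\lVert\mathbf s-\mathbf m_i\rVert^2=d_i$ for $i=1,\dots,4$. A wall is called detected if it is output by the algorithm. A ghost wall is a detected wall that does not exist, i.e. an output whose point $\mathbf s$ is not equal to $\mathrm{ref}_W(\mathbf L)$ for any $W\in\mathcal W$. **Good positions.** A vehicle position is bad if at least one ghost wall is detected. It is good if every wall whose echo is heard by all four microphones is detected and no ghost wall is detected. **Unlucky stacks.** The microphones are deceived by an unlucky stack of mirror points (equivalently, an unlucky stack of mirror points occurs) if there are four, not necessarily distinct, walls in $\mathcal W$ whose mirror points $\mathbf s_1,\dots,\mathbf s_4$ lie on a common vertical line (parallel to the $z$-axis) and such that for all $i,j\in\{1,\dots,4\}$ the $z$-coordinate of $\mathbf s_j-\mathbf s_i$ is twice the $z$-coordinate of $\mathbf m_j-\mathbf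 m_i$ (this does not depend on the vehicle position). *)

(* Defs.v *)
From HB Require Import structures.
From mathcomp Require Import all_boot all_order all_algebra.
From mathcomp Require Import mpoly.
From mathcomp Require Import boolp classical_sets functions cardinality reals.

Set Implicit Arguments.
Unset Strict Implicit.
Unset Printing Implicit Defensive.

Import Order.TTheory GRing.Theory Num.Theory.

Local Open Scope classical_set_scope.
Local Open Scope ring_scope.

Section AffineVarieties.
Variables (R : realType) (N : nat).
Implicit Types (X Z : set 'rV[R]_N) (d : nat).

Definition zariski_closed X : Prop :=
  exists I : set {mpoly R[N]}, X = [set x | forall p, I p -> p.@[x 0] = 0].

Definition irreducible_closed Z : Prop :=
  [/\ zariski_closed Z, Z !=set0 &
      forall A B, zariski_closed A -> zariski_closed B ->
        Z `<=` A `|` B -> Z `<=` A \/ Z `<=` B].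

(* A chain Z 0 < Z 1 < ... < Z d of irreducible closed subsets of X (only the
   first d + 1 values of Z matter). *)
Definition irreducible_chain X d : Prop :=
  exists Z : nat -> set 'rV[R]_N,
    (forall i, (i <= d)%N -> irreducible_closed (Z i) /\ Z i `<=` X) /\
    (forall i, (i < d)%N -> Z i `<` Z i.+1).

(* Krull dimension: the supremum of the lengths of such chains.  The empty set
   has no chain, hence satisfies [dim_lt] for every d (dimension -oo). *)
Definition has_dim X d : Prop :=
  irreducible_chain X d /\ forall e, irreducible_chain X e -> (e <= d)%N.

Definition dim_lt X d : Prop :=
  forall e, irreducible_chain X e -> (e < d)%N.

Definition has_codim X c : Prop :=
  exists2 d, has_dim X d & (d + c = N)%N.

End AffineVarieties.

Section Geometry.
Variable R : realType.
Implicit Types (v x s L : 'cV[R]_3) (P : set 'cV[R]_3).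

Definition zcoord v : R := v ord_max 0.

Definition dot v x : R := \sum_k v k 0 * x k 0.

(* The norm [`|_|] on matrices is the sup norm, hence this definition. *)
Definition sqdist v x : R := \sum_k (v k 0 - x k 0) ^+ 2.

Definition is_plane P : Prop :=
  exists (u : 'cV[R]_3) (c : R), u != 0 /\ P = [set v | dot u v = c].

Definition coplanar (m : 'I_4 -> 'cV[R]_3) : Prop :=
  exists2 P, is_plane P & forall i, P (m i).

Definition is_reflection P x s : Prop :=
  P (2^-1 *: (x + s)) /\ (forall v w, P v -> P w -> dot (s - x) (v - w) = 0).

(* For a plane P there is exactly one point s with [is_reflection P x s];
   the default value x only serves to make [reflection] total. *)
Definition reflection P x : 'cV[R]_3 := xget x (is_reflection P x).

(* The matrix a = (a_ij) consists of the coordinates of an element of ASO(2);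
   its first two columns are the rotation, the last one is the translation. *)
Definition is_ASO2 (a : 'M[R]_(2, 2 + 1)) : Prop :=
  (lsubmx a)^T *m lsubmx a = 1%:M /\ \det (lsubmx a) = 1.

Definition ASO2_map (a : 'M[R]_(2, 2 + 1)) (v : 'cV[R]_(2 + 1)) : 'cV[R]_(2 + 1) :=
  block_mx (lsubmx a) 0 0 1%:M *m v + col_mx (rsubmx a) 0.

Definition ASO2_variety : set 'rV[R]_(2 * (2 + 1)) := mxvec @` [set a | is_ASO2 a].

End Geometry.

Arguments ASO2_variety R : clear implicits.

Section WallDetection.
Variable R : realType.
Local Notation point := 'cV[R]_3.
(* m: microphone positions, W: the walls, H i: the walls heard by microphone i *)
Variables (m : 'I_4 -> point) (L : point).
Variables (W : set (set point)) (H : 'I_4 -> set (set point)).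

Definition f_D (u : 'I_4 -> R) : R :=
  let D := \matrix_(i < 4, j < 4) sqdist (m i) (m j) in
  let b := row_mx (\row_(i < 4) u i) (const_mx 1 : 'M_(1, 1)) in
  \det (block_mx (0 : 'M_1) b b^T (block_mx D (const_mx 1) (const_mx 1) 0)).

Definition echo_data (i : 'I_4) : set R :=
  [set sqdist (reflection P L) (m i) | P in H i].

(* Walls output by the algorithm are represented by their mirror points. *)
Definition detected (s : point) : Prop :=
  exists d : 'I_4 -> R,
    [/\ forall i, echo_data i (d i), f_D d = 0 & forall i, sqdist s (m i) = d i].

Definition ghost (s : point) : Prop :=
  detected s /\ ~ (exists2 P, W P & s = reflection P L).

Definition good_position : Prop :=
  (forall P, (forall i, H i P) -> detected (reflection P L)) /\
  ~ (exists s, ghost s).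

End WallDetection.

(* S is the set of mirror points of the walls. *)
Definition unlucky_stack (R : realType) (m : 'I_4 -> 'cV[R]_3)
    (S : set 'cV[R]_3) : Prop :=
  exists s : 'I_4 -> 'cV[R]_3,
    [/\ forall i, S (s i),
        exists x y : R, forall i, s i 0 0 = x /\ s i 1 0 = y &
        forall i j, zcoord (s j - s i) = 2 * zcoord (m j - m i)].

Definition num_zcoords (R : realType) (m : 'I_4 -> 'cV[R]_3) : nat :=
  size (undup [seq zcoord (m i) | i : 'I_4]).

(* Main.v *)
(* Dimension theory: if Z_0 < ... < Z_e are irreducible closed sets and f_i
   vanishes on Z_i but not on Z_(i+1), then the f_i are algebraically
   independent on Z_e.  On a set parametrized by d real variables with a common
   denominator, the k^e monomials in the f_i with exponents < k pull back, after
   clearing denominators, to polynomials of degree O(k) in each variable; such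
   polynomials are determined by their values on a grid of O(k^d) points, so
   e <= d.

   Part (i): for a 4-tuple tau of mirror points, a point with the same distances
   to the microphones as the tau_i exists only where a certain polynomial in the
   vehicle position vanishes.  ASO(2) is irreducible, so it remains to treat the
   tuples for which this polynomial vanishes identically.  Comparing a few
   positions shows that such tau_i lie on a common vertical line and that, for
   some w, each z_i is either w or 2 zeta_i - w, with zeta_i the height of the
   i-th microphone.  If some z_i is w, the suggested point (x, y, w) is the true
   mirror point tau_i; otherwise tau is an unlucky stack.

   Part (ii): l microphones of distinct heights force l distinct walls whose
   mirror points differ by prescribed vectors, which defines finitely many affine
   subspaces of codimension 3 (l - 1). *)

Require Import Defs.
From HB Require Import structures.
From mathcomp Require Import all_boot all_order all_algebra.
From mathcomp Require Import mpoly.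
From mathcomp Require Import boolp classical_sets functions cardinality reals.
From mathcomp Require Import ring lra zify.

Set Implicit Arguments.
Unset Strict Implicit.
Unset Printing Implicit Defensive.

Import Order.TTheory GRing.Theory Num.Theory.

Local Open Scope classical_set_scope.
Local Open Scope ring_scope.

(** * Zariski closed sets and chains *)

Section PolynomialFunctions.
Variables (R : realType) (N : nat).
Implicit Types (g h : 'rV[R]_N -> R) (X Y Z A B : set 'rV[R]_N).

(** Stated for functions, so that expressions in matrix entries are seen to be polynomial by closure
    rules alone. *)
Definition polynomial_fun g := exists p : {mpoly R[N]}, forall x, g x = p.@[x 0].

Lemma polynomial_fun_cst c : polynomial_fun (fun=> c).
Proof. by exists c%:MP => x; rewrite mevalC. Qed.

Lemma polynomial_fun_coord i : polynomial_fun (fun x => x 0 i).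
Proof. by exists 'X_i => x; rewrite mevalXU. Qed.

Lemma polynomial_funD g h :
  polynomial_fun g -> polynomial_fun h -> polynomial_fun (fun x => g x + h x).
Proof. by move=> [p gp] [q hq]; exists (p + q) => x; rewrite mevalD gp hq. Qed.

Lemma polynomial_funM g h :
  polynomial_fun g -> polynomial_fun h -> polynomial_fun (fun x => g x * h x).
Proof. by move=> [p gp] [q hq]; exists (p * q) => x; rewrite mevalM gp hq. Qed.

Lemma polynomial_funN g : polynomial_fun g -> polynomial_fun (fun x => - g x).
Proof. by move=> [p gp]; exists (- p) => x; rewrite mevalN gp. Qed.

Lemma polynomial_funB g h :
  polynomial_fun g -> polynomial_fun h -> polynomial_fun (fun x => g x - h x).
Proof. by move=> pg ph; apply/polynomial_funD/polynomial_funN. Qed.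

Lemma polynomial_funX g k : polynomial_fun g -> polynomial_fun (fun x => g x ^+ k).
Proof. by move=> [p gp]; exists (p ^+ k) => x; rewrite rmorphXn /= gp. Qed.

Lemma polynomial_fun_sum (I : Type) (r : seq I) (P : pred I) (g : I -> 'rV[R]_N -> R) :
  (forall i, polynomial_fun (g i)) ->
  polynomial_fun (fun x => \sum_(i <- r | P i) g i x).
Proof.
move=> gP; elim: r => [|i r [p IH]].
  by exists 0 => x; rewrite big_nil meval0.
have [q gq] := gP i.
exists (if P i then q + p else p) => x.
by rewrite big_cons; case: (P i); rewrite ?mevalD ?gq IH.
Qed.

Lemma zariski_closed_eq0 g : polynomial_fun g -> zariski_closed [set x | g x = 0].
Proof.
move=> [p gp]; exists [set p]; apply/seteqP; split => x /=.
  by move=> gx0 _ ->; rewrite -gp.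
by move/(_ p erefl); rewrite gp.
Qed.

Lemma zariski_closed_bigcap (I : Type) (F : I -> set 'rV[R]_N) :
  (forall i, zariski_closed (F i)) -> zariski_closed [set x | forall i, F i x].
Proof.
move=> /choice[J FJ]; exists [set p | exists i, J i p].
apply/seteqP; split => x /=.
  by move=> Fx p [i Jip]; move: (Fx i); rewrite FJ; apply.
by move=> H i; rewrite FJ /= => p Jip; apply: H; exists i.
Qed.

Lemma zariski_closedI A B :
  zariski_closed A -> zariski_closed B -> zariski_closed (A `&` B).
Proof.
move=> cA cB.
have -> : A `&` B = [set x | forall b : bool, (if b then A else B) x].
  apply/seteqP; split => x /=; first by move=> [Ax Bx] [].
  by move=> H; split; [apply: (H true) | apply: (H false)].
by apply: zariski_closed_bigcap => -[].
Qed.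

Lemma zariski_closed0 : zariski_closed (set0 : set 'rV[R]_N).
Proof.
have -> : set0 = [set x : 'rV[R]_N | (1 : R) = 0].
  by apply/seteqP; split => x //= /eqP; rewrite oner_eq0.
exact/zariski_closed_eq0/polynomial_fun_cst.
Qed.

Lemma zariski_closedU A B :
  zariski_closed A -> zariski_closed B -> zariski_closed (A `|` B).
Proof.
move=> [I ->] [J ->]; exists [set r | exists p q, [/\ I p, J q & r = p * q]].
apply/seteqP; split => x /=.
  move=> H _ [p [q [Ip Jq ->]]]; rewrite mevalM.
  by case: H => H; [rewrite (H _ Ip) mul0r | rewrite (H _ Jq) mulr0].
(* If some p in I is nonzero at x, then p(x) q(x) = 0 can be divided by p(x) for every q in J. *)
move=> H; have [|nI] := pselect (forall p, I p -> p.@[x 0] = 0); first by left.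
right => q Jq; move/existsNP : nI => [p /not_implyP[Ip /eqP px]].
have /eqP : (p * q).@[x 0] = 0 by apply: H; exists p, q.
by rewrite mevalM mulf_eq0 (negPf px) => /eqP.
Qed.

Lemma zariski_closed_bigcup (I : finType) (P : I -> Prop) (F : I -> set 'rV[R]_N) :
  (forall i, zariski_closed (F i)) ->
  zariski_closed [set x | exists2 i, P i & F i x].
Proof.
move=> cF.
suff H (s : seq I) : zariski_closed [set x | exists2 i, i \in s & P i /\ F i x].
  have -> : [set x | exists2 i, P i & F i x] =
            [set x | exists2 i, i \in enum I & P i /\ F i x].
    apply/seteqP; split => x /= [i]; first by exists i => //; rewrite mem_enum.
    by move=> _ [Pi Fi]; exists i.
  exact: H.
elim: s => [|i s IH].
  rewrite (_ : [set x | _] = set0); first exact: zariski_closed0.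
  by apply/seteqP; split => x //= [].
have cP : zariski_closed [set x | P i /\ F i x].
  have [Pi|nPi] := pselect (P i).
    rewrite (_ : [set x | _] = F i) //.
    by apply/seteqP; split => x //= [].
  rewrite (_ : [set x | _] = set0); first exact: zariski_closed0.
  by apply/seteqP; split => x //= [].
rewrite (_ : [set x | _] =
  [set x | P i /\ F i x] `|` [set x | exists2 i, i \in s & P i /\ F i x]).
  exact: zariski_closedU.
apply/seteqP; split => x /=.
  move=> [j]; rewrite inE => /orP[/eqP->|js]; first by left.
  by right; exists j.
move=> [|[j js]]; first by exists i; rewrite ?mem_head.
by exists j; rewrite // inE js orbT.
Qed.

(** Irreducibility splits the pieces off one at a time; the empty union is excluded because Z has a
    point. *)
Lemma irreducible_bigcup (I : finType) (P : I -> Prop) (F : I -> set 'rV[R]_N) Z :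
  irreducible_closed Z -> (forall i, zariski_closed (F i)) ->
  Z `<=` [set x | exists2 i, P i & F i x] -> exists2 i, P i & Z `<=` F i.
Proof.
move=> [cZ [z Zz] irrZ] cF ZF.
suff H (s : seq I) : Z `<=` [set x | exists2 i, P i /\ i \in s & F i x] ->
    exists2 i, P i & Z `<=` F i.
  apply: (H (enum I)) => x /ZF[i Pi Fi].
  by exists i => //; split => //; rewrite mem_enum.
elim: s => [/(_ z Zz)[i []]//|i s IH ZiF].
have [Pi|nPi] := pselect (P i); last first.
  apply: IH => x /ZiF[j [Pj]]; rewrite inE => /orP[/eqP ji|js] Fj; first by rewrite ji in Pj.
  by exists j.
have : Z `<=` F i `|` [set x | exists2 i, P i /\ i \in s & F i x].
  move=> x /ZiF[j [Pj]]; rewrite inE => /orP[/eqP ->|js] Fj; first by left.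
  by right; exists j.
case/irrZ => //; first exact: zariski_closed_bigcup.
by exists i.
Qed.

Lemma irreducible_mul_eq0 Z g h : irreducible_closed Z ->
  polynomial_fun g -> polynomial_fun h -> (forall x, Z x -> g x * h x = 0) ->
  (forall x, Z x -> g x = 0) \/ (forall x, Z x -> h x = 0).
Proof.
move=> [_ _ irrZ] pg ph gh0.
apply: (irrZ [set x | g x = 0] [set x | h x = 0]); [exact: zariski_closed_eq0..|].
by move=> x /gh0/eqP; rewrite mulf_eq0 => /orP[]/eqP; [left|right].
Qed.

(** Applied to consecutive members of a chain, this yields the functions f_i of the dimension
    bound. *)
Lemma zariski_closed_separated A B : zariski_closed A -> ~ (B `<=` A) ->
  exists g, [/\ polynomial_fun g, forall x, A x -> g x = 0 &
                exists2 x, B x & g x != 0].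
Proof.
move=> [I ->] /existsNP[x /not_implyP[Bx /existsNP[p /not_implyP[Ip /eqP px]]]].
exists (fun x => p.@[x 0]); split; [by exists p | by move=> y; apply | by exists x].
Qed.

Lemma irreducible_chain_sub X Y e :
  X `<=` Y -> irreducible_chain X e -> irreducible_chain Y e.
Proof.
move=> XY [Z [ZX Zlt]]; exists Z; split => // i ie.
by have [? ZiX] := ZX i ie; split => //; apply: subset_trans XY.
Qed.

Lemma chain_top_sub (Z : nat -> set 'rV[R]_N) e :
  (forall i, (i < e)%N -> Z i `<` Z i.+1) -> forall i, (i <= e)%N -> Z i `<=` Z e.
Proof.
elim: e => [|e IH] Zlt i; first by rewrite leqn0 => /eqP->.
rewrite leq_eqVlt => /orP[/eqP->//|]; rewrite ltnS => ie.
apply: (subset_trans (IH _ _ ie)); first by move=> j /ltnW; apply: Zlt.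
by have [] := Zlt e (ltnSn _).
Qed.

Lemma irreducible_chain_extend X Y e : X `<=` Y -> ~ (Y `<=` X) ->
  irreducible_closed Y -> irreducible_chain X e -> irreducible_chain Y e.+1.
Proof.
move=> XY nYX irrY [Z [ZX Zlt]].
exists (fun i => if (i <= e)%N then Z i else Y); split => i ie.
  case: ifP => [/ZX[? ZiX]|_]; first by split => //; apply: subset_trans XY.
  by split.
rewrite -ltnS ie; case: ltnP => ie'; first exact: Zlt.
have [_ ZiX] := ZX i ie; split; first exact: subset_trans XY.
by move=> /subset_trans/(_ ZiX).
Qed.

(** Adding Y on top makes any chain in X longer by one. *)
Lemma irreducible_proper_dim_lt X Y d : irreducible_closed Y -> has_dim Y d ->
  X `<=` Y -> ~ (Y `<=` X) -> dim_lt X d.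
Proof. by move=> irrY [_ Yd] XY nYX e /(irreducible_chain_extend XY nYX irrY)/Yd. Qed.

(** The top member of a chain is irreducible, hence lies in a single piece, and the whole chain with
    it. *)
Lemma has_dim_bigcup (I : finType) (P : I -> Prop) (F : I -> set 'rV[R]_N) d :
  (exists i, P i) -> (forall i, zariski_closed (F i)) ->
  (forall i, P i -> has_dim (F i) d) -> has_dim [set x | exists2 i, P i & F i x] d.
Proof.
move=> [i0 Pi0] cF dF; split.
  apply: irreducible_chain_sub (dF i0 Pi0).1 => x Fx; by exists i0.
move=> e [Z [ZU Zlt]]; have [irrZ ZeU] := ZU e (leqnn e).
have [i Pi ZF] := irreducible_bigcup irrZ cF ZeU.
apply: (dF i Pi).2; exists Z; split => // j je; split; first by have [] := ZU j je.
exact: subset_trans (chain_top_sub Zlt je) ZF.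
Qed.

End PolynomialFunctions.

(** * Polynomials in each variable separately *)

Section SeparatelyPolynomial.
Variables (R : realType) (d : nat).
Implicit Types (x y : 'rV[R]_d) (g h : 'rV[R]_d -> R) (D : nat).

Definition upd x (i : 'I_d) (t : R) : 'rV[R]_d :=
  \row_j (if j == i then t else x 0 j).

Lemma upd_id x i : upd x i (x 0 i) = x.
Proof. by apply/rowP => j; rewrite mxE; case: eqP => // ->. Qed.

Definition sep_poly D g := forall x i,
  exists2 p : {poly R}, (size p <= D.+1)%N & forall t, g (upd x i t) = p.[t].

Lemma sep_poly_leq D D' g : (D <= D')%N -> sep_poly D g -> sep_poly D' g.
Proof.
move=> DD' gP x i; have [p sp pE] := gP x i.
by exists p => //; apply: leq_trans sp _.
Qed.

Lemma sep_poly_cst c : sep_poly 0 (fun=> c).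
Proof. by move=> x i; exists c%:P => [|t]; rewrite ?size_polyC_leq1 ?hornerC. Qed.

Lemma sep_poly_coord j : sep_poly 1 (fun x => x 0 j).
Proof.
move=> x i; have [->|ji] := eqVneq j i.
  by exists 'X => [|t]; rewrite ?size_polyX ?hornerX // mxE eqxx.
exists (x 0 j)%:P => [|t]; last by rewrite mxE (negPf ji) hornerC.
exact: leq_trans (size_polyC_leq1 _) _.
Qed.

Lemma sep_polyD D g h : sep_poly D g -> sep_poly D h -> sep_poly D (fun x => g x + h x).
Proof.
move=> gP hP x i; have [p sp pE] := gP x i; have [q sq qE] := hP x i.
exists (p + q) => [|t]; last by rewrite hornerD pE qE.
by rewrite (leq_trans (size_polyD _ _)) // geq_max sp.
Qed.

Lemma sep_poly_sum D (I : Type) (r : seq I) (g : I -> 'rV[R]_d -> R) :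
  (forall i, sep_poly D (g i)) -> sep_poly D (fun x => \sum_(i <- r) g i x).
Proof.
move=> gP; elim: r => [|i r IH].
  under [X in sep_poly _ X]funext do rewrite big_nil.
  exact: sep_poly_leq (leq0n D) (sep_poly_cst 0).
under [X in sep_poly _ X]funext do rewrite big_cons.
exact: sep_polyD (gP i) IH.
Qed.

Lemma sep_polyM D D' g h :
  sep_poly D g -> sep_poly D' h -> sep_poly (D + D') (fun x => g x * h x).
Proof.
move=> gP hP x i; have [p sp pE] := gP x i; have [q sq qE] := hP x i.
exists (p * q) => [|t]; last by rewrite hornerM pE qE.
apply: (leq_trans (size_polyMleq _ _)); lia.
Qed.

Lemma sep_polyX D g k : sep_poly D g -> sep_poly (k * D) (fun x => g x ^+ k).
Proof.
move=> gP; elim: k => [|k IH]; first exact: sep_poly_cst.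
under [X in sep_poly _ X]funext do rewrite exprS.
by rewrite mulSn; exact: sep_polyM gP IH.
Qed.

Lemma sep_poly_grid D g : sep_poly D g ->
  (forall u : {ffun 'I_d -> 'I_D.+1}, g (\row_j (u j)%:R) = 0) -> forall x, g x = 0.
Proof.
move=> gP g0.
suff H k : (k <= d)%N -> forall (u : {ffun 'I_d -> 'I_D.+1}) x,
    (forall j : 'I_d, (k <= j)%N -> x 0 j = (u j)%:R) -> g x = 0.
  by move=> x; apply: (H d (leqnn _) [ffun=> ord0]) => j; rewrite leqNgt ltn_ord.
elim: k => [_|k IH kd] u x xu.
  rewrite -(g0 u); congr g; apply/rowP => j; rewrite mxE; exact: xu.
(* Along coordinate k the function is a polynomial of degree at most D, and by induction it has the
   D + 1 roots 0, ..., D. *)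
pose i := Ordinal kd; have [p sp pE] := gP x i.
suff p0 : p = 0 by rewrite -[x](upd_id x i) pE p0 horner0.
pose rs := [seq (nat_of_ord t)%:R : R | t <- enum 'I_D.+1].
apply: (@roots_geq_poly_eq0 _ _ rs).
- apply/allP => _ /mapP[t _ ->]; rewrite rootE -pE; apply/eqP.
  apply: (IH (ltnW kd) [ffun j => if j == i then t else u j]) => j kj.
  rewrite mxE ffunE; case: eqP => // /eqP ji; apply: xu.
  by rewrite ltn_neqAle kj andbT; apply: contra ji => /eqP kj'; apply/eqP/val_inj.
- rewrite map_inj_uniq ?enum_uniq // => a b /eqP.
  by rewrite eqr_nat => /eqP/val_inj.
- by rewrite size_map size_enum_ord.
Qed.

Lemma poly_common_nonroot (p q : {poly R}) : p != 0 -> q != 0 ->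
  exists t, p.[t] != 0 /\ q.[t] != 0.
Proof.
move=> p0 q0; have pq0 : p * q != 0 by rewrite mulf_neq0.
pose rs := [seq k%:R : R | k <- iota 0 (size (p * q))].
have : ~~ all (root (p * q)) rs.
  apply: contra pq0 => rP; apply/eqP/(roots_geq_poly_eq0 rP).
    rewrite map_inj_uniq ?iota_uniq // => a b /eqP.
    by rewrite eqr_nat => /eqP.
  by rewrite size_map size_iota.
by case/allPn => t _; rewrite rootM negb_or => /andP[? ?]; exists t.
Qed.

(** A nonzero of g and a nonzero of h are moved together one coordinate at a time, each time to a
    value that is a root of neither one-variable polynomial. At the end they coincide. *)
Lemma sep_poly_integral D D' g h : sep_poly D g -> sep_poly D' h ->
  (forall x, g x * h x = 0) -> (forall x, g x = 0) \/ (forall x, h x = 0).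
Proof.
move=> gP hP gh0; apply: contrapT => /not_orP[/existsNP[x /eqP gx] /existsNP[y /eqP hy]].
suff H k : (k <= d)%N -> exists x y, [/\ g x != 0, h y != 0 &
    forall j : 'I_d, (j < k)%N -> x 0 j = y 0 j].
  have [x' [y' [gx' hy' xy]]] := H d (leqnn _).
  have xy' : x' = y' by apply/rowP => j; apply: xy.
  by move/eqP: (gh0 x'); rewrite mulf_eq0 (negPf gx') {1}xy' (negPf hy').
elim: k => [_|k IH kd]; first by exists x, y.
have [x' [y' [gx' hy' xy]]] := IH (ltnW kd).
pose i := Ordinal kd; have [p _ pE] := gP x' i; have [q _ qE] := hP y' i.
have p0 : p != 0.
  by apply: contraNneq gx' => p0; rewrite -(upd_id x' i) pE p0 horner0.
have q0 : q != 0.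
  by apply: contraNneq hy' => q0; rewrite -(upd_id y' i) qE q0 horner0.
have [t [pt qt]] := poly_common_nonroot p0 q0.
exists (upd x' i t), (upd y' i t); rewrite pE qE; split => // j.
rewrite ltnS leq_eqVlt !mxE; have [//|ji] := eqVneq j i; case/orP => [jk|/xy//].
by rewrite -val_eqE /= jk in ji.
Qed.

Variable q : 'rV[R]_d -> R.
(** The denominators are powers of the fixed function [q]. *)
Definition sep_rational g :=
  exists r D, sep_poly D (fun x => g x * q x ^+ r).

Hypothesis (qP : exists D, sep_poly D q) (q_neq0 : forall x, q x != 0).

Lemma sep_rational_cst c : sep_rational (fun=> c).
Proof.
exists 0, 0; under [X in sep_poly _ X]funext do rewrite mulr1.
exact: sep_poly_cst.
Qed.

(** Passing to a larger exponent multiplies by a further power of [q], at a cost of [Dq] in degree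
    per factor. *)
Lemma sep_rational_uniform g r D r' D' Dq : sep_poly Dq q ->
  (r <= r')%N -> (D + (r' - r) * Dq <= D')%N ->
  sep_poly D (fun x => g x * q x ^+ r) -> sep_poly D' (fun x => g x * q x ^+ r').
Proof.
move=> qD rr' DD' gP.
have -> : (fun x => g x * q x ^+ r') = (fun x => (g x * q x ^+ r) * q x ^+ (r' - r)).
  by apply/funext => x; rewrite -mulrA -exprD subnKC.
apply: sep_poly_leq DD' _.
by apply: sep_polyM => //; apply: sep_polyX.
Qed.

Lemma sep_rationalD g h :
  sep_rational g -> sep_rational h -> sep_rational (fun x => g x + h x).
Proof.
move=> [r [D gP]] [r' [D' hP]]; have [Dq qD] := qP.
exists (r + r')%N, (D + D' + (r + r') * Dq)%N.
under [X in sep_poly _ X]funext do rewrite mulrDl.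
have gP' : sep_poly (D + D' + (r + r') * Dq) (fun x => g x * q x ^+ (r + r')).
  by apply: (sep_rational_uniform qD _ _ gP); rewrite ?leq_addr //; nia.
have hP' : sep_poly (D + D' + (r + r') * Dq) (fun x => h x * q x ^+ (r + r')).
  by apply: (sep_rational_uniform qD _ _ hP); rewrite ?leq_addl //; nia.
exact: sep_polyD gP' hP'.
Qed.

Lemma sep_rationalM g h :
  sep_rational g -> sep_rational h -> sep_rational (fun x => g x * h x).
Proof.
move=> [r [D gP]] [r' [D' hP]].
exists (r + r')%N, (D + D')%N.
under [X in sep_poly _ X]funext do rewrite exprD mulrACA.
exact: sep_polyM gP hP.
Qed.

Lemma sep_rationalX g k : sep_rational g -> sep_rational (fun x => g x ^+ k).
Proof.
move=> gP; elim: k => [|k IH]; first exact: sep_rational_cst.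
under [X in sep_rational X]funext do rewrite exprS.
exact: sep_rationalM gP IH.
Qed.

Lemma sep_rational_sum (I : Type) (s : seq I) (g : I -> 'rV[R]_d -> R) :
  (forall i, sep_rational (g i)) -> sep_rational (fun x => \sum_(i <- s) g i x).
Proof.
move=> gP; elim: s => [|i s IH].
  under [X in sep_rational X]funext do rewrite big_nil.
  exact: sep_rational_cst.
under [X in sep_rational X]funext do rewrite big_cons.
exact: sep_rationalD (gP i) IH.
Qed.

Lemma sep_rational_prod (I : Type) (s : seq I) (g : I -> 'rV[R]_d -> R) :
  (forall i, sep_rational (g i)) -> sep_rational (fun x => \prod_(i <- s) g i x).
Proof.
move=> gP; elim: s => [|i s IH].
  under [X in sep_rational X]funext do rewrite big_nil.
  exact: sep_rational_cst.
under [X in sep_rational X]funext do rewrite big_cons.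
exact: sep_rationalM (gP i) IH.
Qed.

Lemma sep_rational_integral g h : sep_rational g -> sep_rational h ->
  (forall x, g x * h x = 0) -> (forall x, g x = 0) \/ (forall x, h x = 0).
Proof.
move=> [r [D gP]] [r' [D' hP]] gh0.
have qr x k : (q x ^+ k == 0) = false by rewrite expf_eq0 (negPf (q_neq0 x)) andbF.
case: (sep_poly_integral gP hP) => [x|H|H]; first by rewrite mulrACA gh0 mul0r.
  by left => x; move/eqP: (H x); rewrite mulf_eq0 qr orbF => /eqP.
by right => x; move/eqP: (H x); rewrite mulf_eq0 qr orbF => /eqP.
Qed.

Lemma sep_rational_polynomial_fun N (phi : 'rV[R]_d -> 'rV[R]_N) (g : 'rV[R]_N -> R) :
  (forall i, sep_rational (fun y => phi y 0 i)) ->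
  polynomial_fun g -> sep_rational (fun y => g (phi y)).
Proof.
move=> phiP [p gp]; under [X in sep_rational X]funext => y do rewrite gp mevalE.
apply: sep_rational_sum => m; apply: sep_rationalM; first exact: sep_rational_cst.
by apply: sep_rational_prod => i; apply: sep_rationalX.
Qed.

End SeparatelyPolynomial.

(** * Dimension of parametrized sets *)

(** The recursion on e lets the last function of the chain be split off from a monomial. *)
Fixpoint exponents (k e : nat) : finType :=
  if e is e'.+1 then ('I_k * exponents k e')%type else unit.

Lemma card_exponents k e : #|exponents k e| = (k ^ e)%N.
Proof. by elim: e => [|e IH] /=; rewrite ?card_unit // card_prod card_ord IH expnS. Qed.

Section Monomials.
Variables (R : realType) (T : Type) (f : nat -> T -> R).

Fixpoint monomial k e : exponents k e -> T -> R :=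
  if e is e'.+1 return exponents k e -> T -> R
  then fun a x => f e' x ^+ a.1 * monomial a.2 x else fun _ _ => 1.

End Monomials.

(** A homogeneous linear system with more unknowns than equations has a nonzero solution. *)
Lemma nontrivial_relation (F : fieldType) (A G : finType) (M : A -> G -> F) :
  (#|G| < #|A|)%N ->
  exists2 c : A -> F, exists a, c a != 0 & forall g, \sum_a c a * M a g = 0.
Proof.
move=> GA; pose B := \matrix_(i < #|A|, j < #|G|) M (enum_val i) (enum_val j).
have : kermx B != 0.
  rewrite -mxrank_eq0 mxrank_ker -lt0n subn_gt0.
  exact: leq_ltn_trans (rank_leq_col _) GA.
case/rowV0Pn => v /sub_kermxP vB v0.
exists (fun a => v 0 (enum_rank a)).
  move: v0; apply: contra_neqP => /forallNP v0; apply/rowP => i; rewrite mxE.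
  by move/negP: (v0 (enum_val i)); rewrite enum_valK negbK => /eqP.
move=> g; move/rowP/(_ (enum_rank g)): vB; rewrite !mxE => vBg; rewrite -[RHS]vBg.
rewrite [LHS](reindex_onto enum_val enum_rank) /=; last by move=> a _; rewrite enum_rankK.
by apply: eq_big => i; rewrite ?enum_valK ?eqxx // mxE enum_rankK.
Qed.

Section Dimension.
Variables (R : realType) (N : nat).
Implicit Types (X Y Z A : set 'rV[R]_N).

Lemma polynomial_fun_monomial (f : nat -> 'rV[R]_N -> R) k e (a : exponents k e) :
  (forall i, (i < e)%N -> polynomial_fun (f i)) -> polynomial_fun (monomial f a).
Proof.
elim: e a => [|e IH] a fP /=; first exact: polynomial_fun_cst.
apply: polynomial_funM; first exact/polynomial_funX/fP.
by apply: IH => i /ltnW; apply: fP.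
Qed.

(* [f e.-1] vanishes on [Z e.-1]: restricting a relation to [Z e.-1] kills its
   terms free of [f e.-1], and irreducibility of [Z e] lets one divide the rest
   by [f e.-1]. *)
Lemma chain_monomials_free (Z : nat -> set 'rV[R]_N) (f : nat -> 'rV[R]_N -> R) e :
  (forall i, (i <= e)%N -> irreducible_closed (Z i)) ->
  (forall i, (i < e)%N -> [/\ polynomial_fun (f i), Z i `<=` Z i.+1,
     forall x, Z i x -> f i x = 0 & exists2 x, Z i.+1 x & f i x != 0]) ->
  forall k (c : exponents k e -> R),
    (forall x, Z e x -> \sum_a c a * monomial f a x = 0) -> forall a, c a = 0.
Proof.
move=> irrZ fP k; elim: e irrZ fP => [|e IH] irrZ fP c c0.
  move=> a; have [_ [x Zx] _] := irrZ 0%N isT.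
  by rewrite -[RHS](c0 x Zx) (bigD1 a) //= mulr1 big1 ?addr0 //.
have [pf ZZ f0 [y Zy fy]] := fP e (ltnSn e).
have irrZe i : (i <= e)%N -> irreducible_closed (Z i) by move/leqW; apply: irrZ.
have fPe i : (i < e)%N -> [/\ polynomial_fun (f i), Z i `<=` Z i.+1,
    forall x, Z i x -> f i x = 0 & exists2 x, Z i.+1 x & f i x != 0].
  by move/leqW; apply: fP.
pose S (P : exponents k e -> R) x := \sum_b P b * monomial f b x.
have pS P : polynomial_fun (S P).
  apply: polynomial_fun_sum => b; apply: polynomial_funM.
    exact: polynomial_fun_cst.
  by apply: polynomial_fun_monomial => i /fPe[].
have H n (P : nat -> exponents k e -> R) :
    (forall x, Z e.+1 x -> \sum_(j < n) f e x ^+ j * S (P j) x = 0) ->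
    forall j, (j < n)%N -> forall b, P j b = 0.
  elim: n P => // n IHn P P0.
  have P00 : forall b, P 0%N b = 0.
    apply: (IH irrZe fPe) => x Zx; have := P0 x (ZZ x Zx).
    rewrite big_ord_recl mul1r big1 ?addr0 // => j _.
    by rewrite f0 // expr0n /= mul0r.
  have Q0 x : Z e.+1 x -> \sum_(j < n) f e x ^+ j * S (P j.+1) x = 0.
    pose Q x := \sum_(j < n) f e x ^+ j * S (P j.+1) x.
    have pQ : polynomial_fun Q.
      apply: polynomial_fun_sum => j; apply: polynomial_funM => //.
      exact: polynomial_funX.
    have fQ z : Z e.+1 z -> f e z * Q z = 0.
      move=> Zz; rewrite -(P0 z Zz) big_ord_recl /= [S (P 0%N) z]big1 => [|b _].
        rewrite mulr0 add0r mulr_sumr; apply: eq_bigr => j _.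
        by rewrite exprS mulrA.
      by rewrite P00 mul0r.
    case: (irreducible_mul_eq0 (irrZ e.+1 (leqnn _)) pf pQ fQ) => [fe|QZ]; last exact: QZ.
    by rewrite fe ?eqxx in fy.
  case=> [_|j]; first exact: P00.
  by rewrite ltnS => jn; apply: (IHn (fun j => P j.+1) Q0).
(* The coefficients are extended by 0 to all natural exponents, so that the induction in [H] can
   shift them. *)
pose P j b := if insub j is Some j' then c (j', b) else 0.
have PE (j : 'I_k) b : P j b = c (j, b) by rewrite /P valK.
case=> j b; rewrite -PE; apply: (H k P) => // x Zx.
rewrite -[RHS](c0 x Zx).
transitivity (\sum_(i < k) \sum_(b' : exponents k e)
    c (i, b') * (f e x ^+ i * monomial f b' x)).
  apply: eq_bigr => i _; rewrite /S mulr_sumr; apply: eq_bigr => b' _.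
  by rewrite PE mulrCA.
by rewrite pair_bigA; apply: eq_bigr => -[].
Qed.

(** * Sets with a Zariski dense rational parametrization *)

Section Parametrization.
Variables (d : nat) (q : 'rV[R]_d -> R) (phi : 'rV[R]_d -> 'rV[R]_N) (X : set 'rV[R]_N).
Hypotheses (qP : exists D, sep_poly D q) (q_neq0 : forall y, q y != 0).
Hypothesis phiP : forall i, sep_rational q (fun y => phi y 0 i).
Hypothesis phiX : forall y, X (phi y).
Hypothesis dense : forall A, zariski_closed A -> (forall y, A (phi y)) -> X `<=` A.

(** If neither A nor B contains X, density gives g vanishing on A and h on B, both nonzero somewhere
    along [phi]. Their pulled-back product vanishes, against the absence of zero divisors. *)
Lemma irreducible_parametrized : zariski_closed X -> irreducible_closed X.
Proof.
move=> cX; split=> // [|A B cA cB XAB]; first by exists (phi 0).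
apply: contrapT => /not_orP[nA nB].
have [|g [pg gA [x Xx gx]]] := zariski_closed_separated cA (B := range phi).
  by move=> AP; apply/nA/(dense cA) => y; apply: AP; exists y.
have [|h [ph hB [z Xz hz]]] := zariski_closed_separated cB (B := range phi).
  by move=> BP; apply/nB/(dense cB) => y; apply: BP; exists y.
move: Xx Xz gx hz => [y _ <-] [y' _ <-] gy hy.
have rP := sep_rational_polynomial_fun qP phiP.
case: (sep_rational_integral q_neq0 (rP g pg) (rP h ph)) => [t|H|H].
- by case: (XAB _ (phiX t)) => [/gA->|/hB->]; rewrite ?mul0r ?mulr0.
- by rewrite H eqxx in gy.
- by rewrite H eqxx in hy.
Qed.

(** A factor with exponent j < k is padded with the missing q^((k - j) r), so that all monomials
    share one denominator; each of the e factors then costs degree at most k (D + r D). *)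
Lemma sep_poly_monomial (g : nat -> 'rV[R]_d -> R) r D k e (a : exponents k e) :
  (forall i, (i < e)%N -> sep_poly D (fun y => g i y * q y ^+ r)) -> sep_poly D q ->
  sep_poly (e * k * (D + r * D)) (fun y => monomial g a y * q y ^+ (e * k * r)).
Proof.
move=> gP qD; elim: e a gP => [|e IH] a gP.
  rewrite !mul0n; under [X in sep_poly _ X]funext do rewrite mulr1.
  exact: sep_poly_cst.
case: a => j a /=.
have -> : (fun y => g e y ^+ j * monomial g a y * q y ^+ (e.+1 * k * r)) =
   (fun y => ((g e y * q y ^+ r) ^+ j * q y ^+ ((k - j) * r)) *
             (monomial g a y * q y ^+ (e * k * r))).
  apply/funext => y; rewrite exprMn -exprM mulrACA -!mulrA; congr (_ * _).
  rewrite [RHS]mulrCA; congr (_ * _).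
  rewrite -!exprD; congr (_ ^+ _).
  have := ltn_ord j; nia.
have ge : sep_poly (k * (D + r * D))
    (fun y => (g e y * q y ^+ r) ^+ j * q y ^+ ((k - j) * r)).
  have H1 := sep_polyX j (gP e (ltnSn e)); have H2 := sep_polyX ((k - j) * r) qD.
  apply: sep_poly_leq (sep_polyM H1 H2).
  have := ltn_ord j; nia.
apply: sep_poly_leq (sep_polyM ge (IH a _)); last by move=> i /ltnW; apply: gP.
by rewrite -mulnDl mulSn.
Qed.

Lemma sep_rational_common (e : nat) (g : nat -> 'rV[R]_d -> R) :
  (forall i, (i < e)%N -> sep_rational q (g i)) ->
  exists r D, sep_poly D q /\
    forall i, (i < e)%N -> sep_poly D (fun y => g i y * q y ^+ r).
Proof.
have [Dq qD] := qP.
elim: e => [|e IH] gP; first by exists 0%N, Dq.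
have [|r [D [_ H]]] := IH; first by move=> i /leqW; apply: gP.
have [r' [D' H']] := gP e (ltnSn e).
exists (r + r')%N, (Dq + D + D' + (r + r') * Dq)%N; split.
  by apply: sep_poly_leq qD; lia.
move=> i; rewrite ltnS leq_eqVlt => /orP[/eqP->|ie].
  by apply: (sep_rational_uniform qD _ _ H'); rewrite ?leq_addl //; nia.
by apply: (sep_rational_uniform qD _ _ (H i ie)); rewrite ?leq_addr //; nia.
Qed.

Lemma dim_le_parametrized e : irreducible_chain X e -> (e <= d)%N.
Proof.
move=> [Z [ZX Zlt]]; rewrite leqNgt; apply/negP => de.
have /choice[f fP] i : exists f : 'rV[R]_N -> R, (i < e)%N ->
    [/\ polynomial_fun f, Z i `<=` Z i.+1,
     forall x, Z i x -> f x = 0 & exists2 x, Z i.+1 x & f x != 0].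
  case: (ltnP i e) => ie; last by exists (fun=> 0).
  have [Zi nZi] := Zlt i ie; have [[cZ _ _] _] := ZX i (ltnW ie).
  have [g [pg g0 gx]] := zariski_closed_separated cZ nZi.
  by exists g.
have irrZ i : (i <= e)%N -> irreducible_closed (Z i) by move/ZX => [].
pose g i y := f i (phi y).
have [r [D [qD gP]]] : exists r D, sep_poly D q /\
    forall i, (i < e)%N -> sep_poly D (fun y => g i y * q y ^+ r).
  apply: sep_rational_common => i /fP[pf _ _ _].
  exact: sep_rational_polynomial_fun.
(* With d < e, the choice k > C^d gives (K + 1)^d <= (C k)^d < k^(d + 1) <= k^e: there are fewer
   grid points than monomials. *)
set C := (e * (D + r * D)).+1; set k := (C ^ d).+1.
set K := (e * k * (D + r * D))%N.
have card_lt : (#|{ffun 'I_d -> 'I_K.+1}| < #|exponents k e|)%N.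
  rewrite card_exponents card_ffun !card_ord.
  apply: (@leq_ltn_trans ((C * k) ^ d)%N).
    by case: (posnP d) => [->//|d_gt0]; rewrite leq_exp2r // /C /K; nia.
  apply: (@leq_trans (k ^ d.+1)%N); last by rewrite leq_pexp2l.
  by rewrite expnMn expnS ltn_pmul2r ?expn_gt0.
have [c [a ca] cP] := nontrivial_relation
  (fun a (u : {ffun 'I_d -> 'I_K.+1}) => monomial g a (\row_j (u j)%:R)) card_lt.
pose h x := \sum_a c a * monomial f a x.
have hphi y : h (phi y) = \sum_a c a * monomial g a y.
  apply: eq_bigr => b _; congr (_ * _).
  by elim: (e) b => //= e' IH [j b] /=; rewrite IH.
(* Vanishing along [phi] extends to X by density, hence to [Z e], where the monomials are linearly
   independent. *)
suff h0 y : h (phi y) = 0.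
  move/eqP: ca; apply; apply: (chain_monomials_free irrZ fP) => x Zx.
  have [_ ZeX] := ZX e (leqnn e).
  apply: (dense (A := [set x | h x = 0])) (ZeX _ Zx) => //.
  apply: zariski_closed_eq0; apply: polynomial_fun_sum => b.
  apply: polynomial_funM; first exact: polynomial_fun_cst.
  by apply: polynomial_fun_monomial => i /fP[].
have hK : sep_poly K (fun y => h (phi y) * q y ^+ (e * k * r)).
  have -> : (fun y => h (phi y) * q y ^+ (e * k * r)) =
      (fun y => \sum_a c a * (monomial g a y * q y ^+ (e * k * r))).
    apply/funext => z; rewrite hphi mulr_suml.
    by apply: eq_bigr => b _; rewrite mulrA.
  apply: sep_poly_sum => b.
  by have := sep_polyM (sep_poly_cst (c b)) (sep_poly_monomial b gP qD).
have /eqP : h (phi y) * q y ^+ (e * k * r) = 0.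
  by apply: (sep_poly_grid hK) => u; rewrite hphi cP mul0r.
by rewrite mulf_eq0 expf_eq0 (negPf (q_neq0 y)) andbF orbF => /eqP.
Qed.

End Parametrization.
End Dimension.

(** * Affine subspaces *)

Section AffineSubspaces.
Variables (R : realType) (N : nat).

Definition affine_subspace r (x0 : 'rV[R]_N) (B : 'M[R]_(r, N)) : set 'rV[R]_N :=
  [set x | (x - x0 <= B)%MS].

Lemma polynomial_fun_mulmx p (C : 'M[R]_(N, p)) j :
  polynomial_fun (fun x : 'rV[R]_N => (x *m C) 0 j).
Proof.
under [X in polynomial_fun X]funext do rewrite mxE.
apply: polynomial_fun_sum => k; apply: polynomial_funM.
  exact: polynomial_fun_coord.
exact: polynomial_fun_cst.
Qed.

Lemma zariski_closed_affine_subspace r x0 (B : 'M[R]_(r, N)) :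
  zariski_closed (affine_subspace x0 B).
Proof.
have -> : affine_subspace x0 B = [set x | forall j,
    [set x | (x *m cokermx B) 0 j - (x0 *m cokermx B) 0 j = 0] x].
  apply/seteqP; split => x /=; rewrite /affine_subspace /= submxE mulmxBl.
    by move=> /eqP/rowP xB j; have := xB j; rewrite !mxE.
  by move=> xB; apply/eqP/rowP => j; have := xB j; rewrite !mxE.
apply: zariski_closed_bigcap => j; apply: zariski_closed_eq0.
apply: polynomial_funB; first exact: polynomial_fun_mulmx.
exact: polynomial_fun_cst.
Qed.

Section Parametrization.
Variables (r : nat) (x0 : 'rV[R]_N) (B : 'M[R]_(r, N)).
Let phi (y : 'rV[R]_r) := x0 + y *m B.

Let one_poly : exists D, sep_poly D (fun _ : 'rV[R]_r => 1).
Proof. exists 0%N; exact: (@sep_poly_cst R r). Qed.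

Let phi_rational i : sep_rational (fun=> 1) (fun y : 'rV[R]_r => phi y 0 i).
Proof.
exists 0%N, 1%N.
have -> : (fun y => phi y 0 i * 1 ^+ 0) = (fun y => x0 0 i + \sum_j y 0 j * B j i).
  by apply/funext => y; rewrite mulr1 !mxE.
have cst : sep_poly 1 (fun _ : 'rV[R]_r => x0 0 i).
  exact: sep_poly_leq (leq0n _) (sep_poly_cst _).
apply: (sep_polyD cst); apply: sep_poly_sum => j.
exact: (sep_polyM (sep_poly_coord j) (sep_poly_cst _)).
Qed.

Let phi_in y : affine_subspace x0 B (phi y).
Proof. by rewrite /affine_subspace /= addrC addKr submxMl. Qed.

Let phi_dense A : zariski_closed A -> (forall y, A (phi y)) -> affine_subspace x0 B `<=` A.
Proof.
move=> _ Aphi x /submxP[y xy]; have -> : x = phi y by rewrite /phi -xy addrC subrK.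
exact: Aphi.
Qed.

Lemma irreducible_affine_subspace : irreducible_closed (affine_subspace x0 B).
Proof.
apply: (irreducible_parametrized one_poly _ phi_rational phi_in phi_dense).
  by move=> _; exact: oner_neq0.
exact: zariski_closed_affine_subspace.
Qed.

Lemma dim_le_affine_subspace e : irreducible_chain (affine_subspace x0 B) e -> (e <= r)%N.
Proof.
apply: (dim_le_parametrized one_poly _ phi_rational phi_dense).
by move=> _; exact: oner_neq0.
Qed.

End Parametrization.

Lemma affine_subspaceS r r' x0 (B : 'M[R]_(r, N)) (C : 'M[R]_(r', N)) :
  (affine_subspace x0 B `<=` affine_subspace x0 C) <-> (B <= C)%MS.
Proof.
split => [BC|BC x xB]; last exact: submx_trans BC.
apply/row_subP => i; have := BC (x0 + row i B).
by rewrite /affine_subspace /= addrC addKr; apply; apply: row_sub.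
Qed.

Lemma has_dim_affine_subspace r x0 (B : 'M[R]_(r, N)) :
  has_dim (affine_subspace x0 B) (\rank B).
Proof.
have -> : affine_subspace x0 B = affine_subspace x0 (row_base B).
  by apply/seteqP; split; apply/affine_subspaceS; rewrite eq_row_base.
split; last exact: dim_le_affine_subspace.
(* The first i vectors of a basis of the row space span the i-th member of a flag. *)
pose Bi i := pid_mx i *m row_base B : 'M_(\rank B, N).
exists (fun i => affine_subspace x0 (Bi i)); split => i ir.
  split; first exact: irreducible_affine_subspace.
  by apply/affine_subspaceS; rewrite (submx_trans (submxMl _ _)) ?eq_row_base.
split.
  apply/affine_subspaceS/submxP; exists (pid_mx i).
  by rewrite /Bi mulmxA mul_pid_mx; congr (pid_mx _ *m _); lia.
move/affine_subspaceS/mxrankS; rewrite !mxrankMfree ?row_base_free //.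
by rewrite !rank_pid_mx ?ltnn // ltnW.
Qed.

End AffineSubspaces.

(** * The variety ASO(2) *)

Lemma det_mx22 (F : comNzRingType) (A : 'M[F]_2) :
  \det A = A 0 0 * A 1 1 - A 0 1 * A 1 0.
Proof.
rewrite (expand_det_row A 0) big_ord_recl big_ord1 /cofactor !det_mx11 !mxE /=.
have -> : lift 0 0 = 1 :> 'I_2 by apply/val_inj.
have -> : lift 1 0 = 0 :> 'I_2 by apply/val_inj.
by rewrite expr0 expr1 mul1r mulN1r mulrN.
Qed.

Section ASO2.
Variable R : realType.

Definition rotation (c s : R) : 'M[R]_2 :=
  \matrix_(i, j) if i == j then c else if i == 0 then - s else s.

Definition vehicle (c s x y : R) : 'M[R]_(2, 2 + 1) :=
  row_mx (rotation c s) (\col_i if i == 0 then x else y).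

Lemma forall_ord2 (P : 'I_2 -> Prop) : P 0 -> P 1 -> forall i, P i.
Proof.
move=> P0 P1; case=> -[|[|//]] H.
  by rewrite (_ : Ordinal H = 0) //; apply/val_inj.
by rewrite (_ : Ordinal H = 1) //; apply/val_inj.
Qed.

Lemma is_ASO2E (a : 'M[R]_(2, 2 + 1)) : is_ASO2 a <->
  [/\ a 1 (lshift 1 1) = a 0 (lshift 1 0), a 0 (lshift 1 1) = - a 1 (lshift 1 0) &
      a 0 (lshift 1 0) ^+ 2 + a 1 (lshift 1 0) ^+ 2 = 1].
Proof.
rewrite /is_ASO2 det_mx22 !mxE.
set a00 := a 0 _; set a10 := a 1 (lshift 1 0); set a01 := a 0 _; set a11 := a 1 _.
have E i j : ((lsubmx a)^T *m lsubmx a) i j =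
    a 0 (lshift 1 i) * a 0 (lshift 1 j) + a 1 (lshift 1 i) * a 1 (lshift 1 j).
  by rewrite !mxE big_ord_recl big_ord1 !mxE (_ : lift _ _ = 1) //; apply/val_inj.
split.
  move=> [/matrixP aa det1].
  have := aa 0 0; have := aa 0 1; have := aa 1 1; rewrite !E !mxE /=.
  rewrite -/a00 -/a01 -/a10 -/a11 => E11 E01 E00.
  (* The sum of the squared column norms minus twice the determinant is 1 + 1 - 2 = 0, and over the
     reals both squares must vanish. *)
  have E2 : (a11 - a00) ^+ 2 + (a01 + a10) ^+ 2 = 0.
    have -> : (a11 - a00) ^+ 2 + (a01 + a10) ^+ 2 = (a00 * a00 + a10 * a10)
      + (a01 * a01 + a11 * a11) - 2 * (a00 * a11 - a01 * a10) by ring.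
    rewrite E00 E11 det1 /=; ring.
  move/eqP: E2; rewrite paddr_eq0 ?sqr_ge0 // !sqrf_eq0 => /andP[/eqP H1 /eqP H2].
  split; [lra | lra | by rewrite !expr2 E00].
move=> [H1 H2 H3]; split; last by rewrite H1 H2 -[RHS]H3; ring.
apply/matrixP => i j; rewrite E !mxE.
move: i j; apply: forall_ord2; apply: forall_ord2; rewrite -/a00 -/a01 -/a10 -/a11 ?H1 ?H2 /=;
  rewrite ?mulr1n ?mulr0n -?[RHS]H3; ring.
Qed.

Lemma is_ASO2_vehicle c s x y : c ^+ 2 + s ^+ 2 = 1 -> is_ASO2 (vehicle c s x y).
Proof. by move=> cs; apply/is_ASO2E; rewrite /vehicle !row_mxEl !mxE. Qed.

Lemma is_ASO2_vehicleP (a : 'M[R]_(2, 2 + 1)) : is_ASO2 a ->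
  exists c s x y, c ^+ 2 + s ^+ 2 = 1 /\ a = vehicle c s x y.
Proof.
move=> /is_ASO2E[H1 H2 H3].
exists (a 0 (lshift 1 0)), (a 1 (lshift 1 0)), (a 0 (rshift 2 0)), (a 1 (rshift 2 0)).
split => //; apply/matrixP => i j; case: (split_ordP j) => k ->.
  rewrite /vehicle row_mxEl mxE.
  by move: i k; apply: forall_ord2; apply: forall_ord2.
rewrite /vehicle row_mxEr mxE (ord1 k).
by move: i; apply: forall_ord2.
Qed.

Lemma polynomial_fun_vec_mx m n (i : 'I_m) (j : 'I_n) :
  polynomial_fun (fun x : 'rV[R]_(m * n) => vec_mx x i j).
Proof.
under [X in polynomial_fun X]funext do rewrite mxE.
exact: polynomial_fun_coord.
Qed.

Lemma ASO2_varietyE : ASO2_variety R = [set x | is_ASO2 (vec_mx x)].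
Proof.
apply/seteqP; split => [_ [a aP <-] /=|x xP]; first by rewrite mxvecK.
by exists (vec_mx x); rewrite ?vec_mxK.
Qed.

Lemma zariski_closed_ASO2 : zariski_closed (ASO2_variety R).
Proof.
pose p i j (x : 'rV[R]_(2 * (2 + 1))) := vec_mx x i (lshift 1 j).
have pP i j : polynomial_fun (p i j) by apply: polynomial_fun_vec_mx.
have -> : ASO2_variety R = [set x | p 1 1 x - p 0 0 x = 0] `&`
   ([set x | p 0 1 x + p 1 0 x = 0] `&` [set x | p 0 0 x ^+ 2 + p 1 0 x ^+ 2 - 1 = 0]).
  rewrite ASO2_varietyE; apply/seteqP; split => x /=.
    move=> /is_ASO2E[H1 H2 H3]; rewrite /p H1 H2 H3; split; [|split]; ring.
  move=> [H1 [H2 H3]]; apply/is_ASO2E.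
  by split; [apply/eqP; rewrite -subr_eq0; apply/eqP|apply/eqP; rewrite -addr_eq0; apply/eqP|
     apply/eqP; rewrite -subr_eq0; apply/eqP].
apply: zariski_closedI; last apply: zariski_closedI; apply: zariski_closed_eq0.
- exact: polynomial_funB.
- exact: polynomial_funD.
- apply: polynomial_funB; last exact: polynomial_fun_cst.
  by apply: polynomial_funD; apply: polynomial_funX.
Qed.

Let q (u : 'rV[R]_3) := 1 + u 0 0 ^+ 2.

Let q_neq0 u : q u != 0.
Proof. by rewrite gt_eqF // /q ltr_wpDr ?sqr_ge0. Qed.

Let sqr_poly D (g : 'rV[R]_3 -> R) : sep_poly D g -> sep_poly (2 * D) (fun u => g u ^+ 2).
Proof. exact: sep_polyX. Qed.

Let q_poly : exists D, sep_poly D q.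
Proof.
exists 2%N; apply: (@sep_polyD _ _ _ (fun=> 1) (fun u : 'rV[R]_3 => u 0 0 ^+ 2)).
  exact: sep_poly_leq (sep_poly_cst _).
exact: (@sep_polyX _ _ _ _ 2 (sep_poly_coord 0)).
Qed.

(* The rational parametrization of the circle misses its point opposite to
   [sg * (1, 0)]; the sign [sg] provides a second chart around it. *)
Definition ASO2_param (sg : R) (u : 'rV[R]_3) : 'rV[R]_(2 * (2 + 1)) :=
  let q := 1 + u 0 0 ^+ 2 in
  mxvec (vehicle (sg * (1 - u 0 0 ^+ 2) / q) (sg * (2 * u 0 0) / q) (u 0 1) (u 0 ord_max)).

Lemma mxvec_ind m n (P : 'I_(m * n) -> Prop) :
  (forall i j, P (mxvec_index i j)) -> forall k, P k.
Proof. by move=> H k; case/mxvec_indexP: k. Qed.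

Let coord_rational j : sep_rational q (fun u => u 0 j).
Proof.
exists 0%N, 1%N; under [X in sep_poly _ X]funext do rewrite mulr1.
exact: sep_poly_coord.
Qed.

Let quotient_rational D (g : 'rV[R]_3 -> R) :
  sep_poly D g -> sep_rational q (fun u => g u / (1 + u 0 0 ^+ 2)).
Proof.
move=> gP; exists 1%N, D.
have -> // : (fun u => g u / (1 + u 0 0 ^+ 2) * q u ^+ 1) = g.
by apply/funext => u; rewrite expr1 divfK // q_neq0.
Qed.

Lemma ASO2_param_rational sg k : sep_rational q (fun u => ASO2_param sg u 0 k).
Proof.
have t1 : sep_poly 1 (fun u : 'rV[R]_3 => u 0 0) := sep_poly_coord 0.
have cR : sep_rational q (fun u => sg * (1 - u 0 0 ^+ 2) / (1 + u 0 0 ^+ 2)).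
  apply: (@quotient_rational 2 (fun u => sg * (1 - u 0 0 ^+ 2))).
  have -> : (fun u : 'rV[R]_3 => sg * (1 - u 0 0 ^+ 2)) =
            (fun u => sg + (- sg) * u 0 0 ^+ 2) by apply/funext => u; ring.
  apply: sep_polyD; first exact: sep_poly_leq (sep_poly_cst _).
  exact: (sep_polyM (sep_poly_cst _) (sqr_poly t1)).
have sR : sep_rational q (fun u => sg * (2 * u 0 0) / (1 + u 0 0 ^+ 2)).
  apply: (@quotient_rational 1 (fun u => sg * (2 * u 0 0))).
  exact: (sep_polyM (sep_poly_cst _) (sep_polyM (sep_poly_cst _) t1)).
have nsR : sep_rational q (fun u => - (sg * (2 * u 0 0) / (1 + u 0 0 ^+ 2))).
  have -> : (fun u : 'rV[R]_3 => - (sg * (2 * u 0 0) / (1 + u 0 0 ^+ 2))) =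
            (fun u => (-1) * (sg * (2 * u 0 0) / (1 + u 0 0 ^+ 2))).
    by apply/funext => u; rewrite mulN1r.
  exact: (sep_rationalM (sep_rational_cst _ (-1)) sR).
elim/mxvec_ind: k => i j; rewrite /ASO2_param.
under [X in sep_rational _ X]funext do rewrite mxvecE.
case: (split_ordP j) => {}j ->.
  under [X in sep_rational _ X]funext do rewrite /vehicle row_mxEl mxE.
  by case: (i == j) => //; case: (i == 0).
under [X in sep_rational _ X]funext do rewrite /vehicle row_mxEr mxE.
by case: (i == 0).
Qed.

Lemma ASO2_param_in sg u : sg ^+ 2 = 1 -> ASO2_variety R (ASO2_param sg u).
Proof.
move=> sg1; rewrite ASO2_varietyE /ASO2_param /= mxvecK; apply: is_ASO2_vehicle.
have := q_neq0 u; rewrite /q => q0.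
transitivity (sg ^+ 2); last by [].
by field.
Qed.

(** The parameter is the tangent of half the rotation angle, for [sg] = -1 after adding a half
    turn. *)
Lemma ASO2_param_eq sg c s x y : sg ^+ 2 = 1 -> c ^+ 2 + s ^+ 2 = 1 -> 1 + sg * c != 0 ->
  mxvec (vehicle c s x y) =
  ASO2_param sg (\row_j [:: sg * s / (1 + sg * c); x; y]`_j).
Proof.
move=> sg1 cs c1; rewrite /ASO2_param !mxE /=.
set t := sg * s / _.
have c1' : (1 + sg * c) ^+ 2 + s ^+ 2 = 2 * (1 + sg * c).
  transitivity (1 + 2 * (sg * c) + sg ^+ 2 * c ^+ 2 + s ^+ 2); first by ring.
  rewrite sg1 mul1r -addrA cs; ring.
have tE : 1 + t ^+ 2 = 2 / (1 + sg * c).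
  apply: (mulIf (x := (1 + sg * c) ^+ 2)); first by rewrite expf_neq0.
  transitivity ((1 + sg * c) ^+ 2 + sg ^+ 2 * s ^+ 2); first by rewrite /t; field.
  by rewrite sg1 mul1r c1'; field.
have t2 : t ^+ 2 = 2 / (1 + sg * c) - 1 by rewrite -tE; ring.
have c2 : 2 / (1 + sg * c) != 0 by rewrite mulf_neq0 ?invr_neq0 ?pnatr_eq0.
congr (mxvec (vehicle _ _ _ _)); rewrite tE.
  rewrite t2; transitivity (sg ^+ 2 * c); first by rewrite sg1 mul1r.
  by field.
rewrite /t; transitivity (sg ^+ 2 * s); first by rewrite sg1 mul1r.
by field.
Qed.

(** The chart with sign 1 misses only the rotation part -1, which has parameter t = 0 in the other
    chart. If g vanishes on A, then t g vanishes on that whole chart, since t != 0 leads back to the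
    first one; the factor t can be cancelled. *)
Lemma ASO2_param_dense A : zariski_closed A -> (forall u, A (ASO2_param 1 u)) ->
  ASO2_variety R `<=` A.
Proof.
move=> cA Aphi; apply: contrapT.
move=> /(zariski_closed_separated cA)[g [pg gA [_ [a aP <-]]]].
have [c [s [x [y [cs ->]]]]] := is_ASO2_vehicleP aP.
apply/negP; rewrite negbK.
have one2 : (1 : R) ^+ 2 = 1 by rewrite expr1n.
have mone2 : (-1 : R) ^+ 2 = 1 by rewrite sqrrN expr1n.
have [c0|c1] := eqVneq (1 + 1 * c) 0; last first.
  by rewrite (ASO2_param_eq _ _ one2 cs c1) gA.
have mc1 : 1 + (-1) * c != 0 by apply/eqP; lra.
rewrite (ASO2_param_eq _ _ mone2 cs mc1).
have g_rat := sep_rational_polynomial_fun q_poly (ASO2_param_rational (-1)) pg.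
case: (sep_rational_integral q_neq0 (coord_rational 0) g_rat) => [u|H|H].
- have [->|u0] := eqVneq (u 0 0) 0; first by rewrite mul0r.
  have [a' aP' aE] := ASO2_param_in u mone2.
  have [c' [s' [x' [y' [cs' aE']]]]] := is_ASO2_vehicleP aP'.
  have c1' : 1 + 1 * c' != 0.
    suff -> : c' = - ((1 - u 0 0 ^+ 2) / (1 + u 0 0 ^+ 2)).
      rewrite mul1r; have := q_neq0 u; rewrite /q => q0.
      have -> : 1 - (1 - u 0 0 ^+ 2) / (1 + u 0 0 ^+ 2) =
          2 * u 0 0 ^+ 2 / (1 + u 0 0 ^+ 2) by field.
      by rewrite !mulf_neq0 ?invr_neq0 ?expf_neq0 ?pnatr_eq0.
    have : a' 0 (lshift 1 0) = vec_mx (ASO2_param (-1) u) 0 (lshift 1 0) by rewrite -aE mxvecK.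
    by rewrite aE' /ASO2_param mxvecK /vehicle !row_mxEl !mxE /= mulN1r mulNr.
  by rewrite -aE aE' (ASO2_param_eq _ _ one2 cs' c1') gA ?mulr0.
- by have := H (const_mx 1); rewrite mxE => /eqP; rewrite oner_eq0.
- by rewrite H.
Qed.

Lemma irreducible_ASO2 : irreducible_closed (ASO2_variety R).
Proof.
apply: (irreducible_parametrized q_poly q_neq0 (ASO2_param_rational 1)).
- by move=> u; apply: ASO2_param_in; rewrite expr1n.
- exact: ASO2_param_dense.
- exact: zariski_closed_ASO2.
Qed.

(** The parametrization bounds the dimension above. From below, a chain of length 2 in the plane of
    pure translations is extended by the whole group. *)
Lemma has_dim_ASO2 : has_dim (ASO2_variety R) 3.
Proof.
split; last first.
  exact: (dim_le_parametrized q_poly q_neq0 (ASO2_param_rational 1) ASO2_param_dense).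
pose B : 'M[R]_(2, 2 * (2 + 1)) :=
  \matrix_(i < 2) mxvec (row_mx 0 (delta_mx i 0) : 'M_(2, 2 + 1)).
have BE (v : 'rV_2) : v *m B = mxvec (row_mx 0 v^T : 'M_(2, 2 + 1)).
  apply/rowP; apply: mxvec_ind => i j; rewrite mxvecE [LHS]mxE.
  under eq_bigr do rewrite mxE mxvecE.
  case: (split_ordP j) => {}j ->.
    by rewrite row_mxEl mxE big1 // => k _; rewrite row_mxEl mxE mulr0.
  rewrite row_mxEr mxE (bigD1 i) //= row_mxEr mxE !ord1 !eqxx mulr1 big1 ?addr0 // => k ki.
  by rewrite row_mxEr mxE eq_sym (negPf ki) mulr0.
have rB : \rank B = 2%N.
  apply/eqP; rewrite -[_ == _]/(row_free B) -kermx_eq0; apply/rowV0P => v /sub_kermxP.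
  rewrite BE => vB; apply/rowP => i.
  have /matrixP/(_ i (rshift 2 0)) : (row_mx 0 v^T : 'M_(2, 2 + 1)) = 0.
    by rewrite -[LHS]mxvecK vB linear0.
  by rewrite row_mxEr !mxE.
pose x0 := mxvec (vehicle 1 0 0 0).
have [chain _] := has_dim_affine_subspace x0 B; rewrite rB in chain.
apply: irreducible_chain_extend irreducible_ASO2 chain.
  move=> x /submxP[v]; rewrite BE => /eqP; rewrite subr_eq => /eqP ->.
  rewrite ASO2_varietyE /= linearD /= !mxvecK /vehicle add_row_mx; apply/is_ASO2E.
  by rewrite !row_mxEl !mxE /=; split; ring.
(* The half turn shows that the group is larger than the translations. *)
have aso : ASO2_variety R (mxvec (vehicle (-1) 0 0 0)).
  by rewrite ASO2_varietyE /= mxvecK; apply: is_ASO2_vehicle; ring.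
move=> /(_ _ aso)/submxP[v]; rewrite BE -linearB /= => /(congr1 vec_mx).
rewrite !mxvecK /vehicle opp_row_mx add_row_mx => /matrixP/(_ 0 (lshift 1 0)).
by rewrite !row_mxEl !mxE /= => H; move: H; lra.
Qed.

End ASO2.

(** * Unlucky stacks *)

Section UnluckyStacks.
Variables (R : realType) (m : 'I_4 -> 'cV[R]_3).

(** One microphone is chosen per height; each one after the first will contribute three
    equations. *)
Lemma num_zcoords_representatives : exists r : 'I_(num_zcoords m) -> 'I_4,
  injective (fun j => zcoord (m (r j))).
Proof.
pose s := undup [seq zcoord (m i) | i : 'I_4].
have /choice[r rE] (j : 'I_(num_zcoords m)) : exists i, zcoord (m i) = s`_j.
  have : s`_j \in s by rewrite mem_nth.
  by rewrite mem_undup => /mapP[i _ ->]; exists i.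
exists r => j k /=; rewrite !rE => /eqP.
by rewrite nth_uniq ?undup_uniq // => /eqP/val_inj.
Qed.

Lemma num_zcoords_bounds : ~ coplanar m -> (2 <= num_zcoords m <= 4)%N.
Proof.
move=> hm; apply/andP; split; last first.
  by rewrite (leq_trans (size_undup _)) // size_map -cardE card_ord.
(* Microphones of a single height would lie in a horizontal plane. *)
rewrite leqNgt; apply/negP => l1; apply: hm.
have [z zE] : exists z, forall i, zcoord (m i) = z.
  have mem i : zcoord (m i) \in undup [seq zcoord (m i) | i : 'I_4].
    by rewrite mem_undup; apply: (map_f (fun i => zcoord (m i))); rewrite mem_enum.
  move: l1 mem; rewrite /num_zcoords; case: (undup _) => [|z [|//]] _ mem.
    by have := mem 0; rewrite in_nil.
  by exists z => i; have := mem i; rewrite inE => /eqP.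
exists [set v | dot (delta_mx ord_max 0) v = z].
  exists (delta_mx ord_max 0), z; split => //; apply/eqP => /matrixP/(_ ord_max 0).
  by rewrite !mxE !eqxx => /eqP; rewrite oner_eq0.
move=> i; rewrite /= /dot (bigD1 ord_max) //= big1 => [|k kmax].
  by rewrite mxE !eqxx mul1r addr0 -(zE i).
by rewrite mxE (negPf kmax) mul0r.
Qed.

(** * Arrangements with a stack on prescribed walls *)

Section Arrangements.
Variables (n k : nat) (r : 'I_k.+1 -> 'I_4).
Implicit Type f : {ffun 'I_k.+1 -> 'I_n}.

(** Multiplying the matrix of mirror points by this on the right subtracts point [f ord0] from the
    other selected points. *)
Definition stack_differences f : 'M[R]_(n, k) :=
  \matrix_(a, j) ((a == f (lift ord0 j))%:R - (a == f ord0)%:R).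

(** Right multiplication by this puts prescribed differences at the selected walls and 0 at all
    others, including [f ord0], when [f] is injective. It supplies both a particular solution and
    surjectivity. *)
Definition stack_section f : 'M[R]_(k, n) :=
  \matrix_(j, a) (a == f (lift ord0 j))%:R.

Definition stack_shifts : 'M[R]_(3, k) :=
  \matrix_(i, j) (if i == ord_max then
    2 * (zcoord (m (r (lift ord0 j))) - zcoord (m (r ord0))) else 0).

Definition stack_arrangements f : set 'rV[R]_(3 * n) :=
  affine_subspace (mxvec (stack_shifts *m stack_section f))
                  (kermx (lin_mulmxr (stack_differences f))).

Lemma stack_sectionK f : injective f -> stack_section f *m stack_differences f = 1%:M.
Proof.
move=> f_inj; apply/matrixP => i j; rewrite !mxE (bigD1 (f (lift ord0 i))) //=.
rewrite !mxE eqxx mul1r big1 => [|a ai]; last by rewrite mxE (negPf ai) mul0r.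
rewrite !(inj_eq f_inj) (inj_eq lift_inj) [lift _ _ == ord0]eq_sym.
by rewrite (negPf (neq_lift _ _)) subr0 addr0.
Qed.

Lemma mulmx_stack_differences (c : 'M[R]_(3, n)) f i j :
  (c *m stack_differences f) i j = c i (f (lift ord0 j)) - c i (f ord0).
Proof.
rewrite mxE; under eq_bigr do rewrite mxE mulrBr.
rewrite sumrB; congr (_ - _).
  rewrite (bigD1 (f (lift ord0 j))) //= eqxx mulr1 big1 ?addr0 // => a /negPf->.
  by rewrite mulr0.
by rewrite (bigD1 (f ord0)) //= eqxx mulr1 big1 ?addr0 // => a /negPf->; rewrite mulr0.
Qed.

Lemma stack_arrangementsP f c : injective f ->
  stack_arrangements f (mxvec c) <-> c *m stack_differences f = stack_shifts.
Proof.
move=> f_inj; rewrite /stack_arrangements /affine_subspace /=.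
rewrite -linearB /=; split => [/sub_kermxP|cE].
  rewrite mul_vec_lin /= => /(congr1 vec_mx); rewrite mxvecK linear0.
  by rewrite mulmxBl -mulmxA stack_sectionK // mulmx1 => /eqP; rewrite subr_eq0 => /eqP.
apply/sub_kermxP; rewrite mul_vec_lin /= mulmxBl -mulmxA stack_sectionK //.
by rewrite mulmx1 cE subrr linear0.
Qed.

(** The section makes the difference map onto the 3 by k matrices, so its kernel has dimension 3 n -
    3 k. *)
Lemma has_dim_stack_arrangements f : injective f ->
  has_dim (stack_arrangements f) (3 * n - 3 * k).
Proof.
move=> f_inj.
have full : row_full (lin_mulmxr (stack_differences f) : 'M_(3 * n, 3 * k)).
  apply/row_fullP; exists (lin_mulmxr (stack_section f)).
  apply/row_matrixP => i; rewrite !rowE mulmxA mulmx1.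
  rewrite -[delta_mx 0 i]vec_mxK !mul_vec_lin /=.
  by rewrite -mulmxA stack_sectionK // mulmx1.
have := has_dim_affine_subspace (mxvec (stack_shifts *m stack_section f))
  (kermx (lin_mulmxr (stack_differences f))).
by rewrite mxrank_ker (eqP full).
Qed.

End Arrangements.

(** Equal walls for two chosen microphones would have height difference 0, forcing equal microphone
    heights; the common vertical line makes the horizontal differences vanish. *)
Lemma unlucky_stackP n k (r : 'I_k.+1 -> 'I_4) (c : 'M[R]_(3, n)) :
  injective (fun j => zcoord (m (r j))) ->
  unlucky_stack m (range (fun a : 'I_n => col a c)) ->
  exists2 f : {ffun 'I_k.+1 -> 'I_n}, injective f &
    c *m stack_differences f = stack_shifts r.
Proof.
move=> r_inj [s [/(_ _)/cid2-/all_sig[g gE] [x [y sxy]] sz]].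
have {}gE i : col (g i) c = s i by have [] := gE i.
have zE i j : c ord_max (g j) - c ord_max (g i) = 2 * (zcoord (m j) - zcoord (m i)).
  by have := sz i j; rewrite -!gE /zcoord !mxE.
exists [ffun j => g (r j)].
  move=> i j; rewrite !ffunE => gij; apply: r_inj.
  by have := zE (r i) (r j); rewrite gij subrr => H; move: H; lra.
apply/matrixP => i j; rewrite mulmx_stack_differences !ffunE mxE.
case: eqP => [->|imax]; first exact: zE.
have xy p : c i (g p) = if i == 0 then x else y.
  have -> : c i (g p) = s p i 0 by rewrite -gE mxE.
  have [<- <-] := sxy p; case: eqP => [->//|i0]; congr (s p _ 0).
  apply/val_inj; case: i imax i0 => -[|[|[|//]]] H imax i0 //.
    by case: i0; apply/val_inj.
  by case: imax; apply/val_inj.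
by rewrite !xy subrr.
Qed.

Lemma unlucky_arrangements_codim n (hm : ~ coplanar m) :
  let l := num_zcoords m in
  let unlucky := [set c : 'M[R]_(3, n) | unlucky_stack m (range (fun k : 'I_n => col k c))] in
  [/\ (2 <= l <= 4)%N,
      (n < l)%N -> unlucky = set0 &
      (l <= n)%N ->
      exists X : set 'rV[R]_(3 * n),
        [/\ zariski_closed X, has_codim X (3 * (l - 1)) &
            mxvec @` unlucky `<=` X]].
Proof.
move: (num_zcoords_bounds hm) num_zcoords_representatives.
case: (num_zcoords m) => // k l_bounds [r r_inj] l unlucky; split=> //.
  move=> nl; apply/seteqP; split => // c /(unlucky_stackP r_inj)[f f_inj _].
  by have := leq_card f f_inj; rewrite !card_ord leqNgt nl.
move=> kn.
pose X := [set x | exists2 f : {ffun 'I_k.+1 -> 'I_n}, injective f & stack_arrangements r f x].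
exists X; split.
- by apply: zariski_closed_bigcup => f; apply: zariski_closed_affine_subspace.
- exists (3 * n - 3 * k)%N; last by lia.
  apply: has_dim_bigcup.
  (* Here l <= n provides an injective choice of walls, so the union is not empty. *)
  + exists [ffun j => widen_ord kn j] => i j; rewrite !ffunE => /(congr1 val) /= ij.
    exact: val_inj.
  + by move=> f; apply: zariski_closed_affine_subspace.
  + exact: has_dim_stack_arrangements.
- move=> _ [c /(unlucky_stackP r_inj)[f f_inj cE] <-].
  by exists f => //; apply/stack_arrangementsP.
Qed.

End UnluckyStacks.

(** * Vehicle frame and Cayley-Menger determinant *)

Section VehicleFrame.
Variable R : realType.
Implicit Types (p v t : 'cV[R]_3) (c s x y : R).

Lemma sum3 (F : 'I_3 -> R) : \sum_k F k = F 0 + F 1 + F ord_max.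
Proof.
rewrite big_ord_recl big_ord_recl big_ord1 addrA.
by congr (_ + F _ + F _); apply/val_inj.
Qed.

Lemma sqdistE v p : sqdist v p =
  (v 0 0 - p 0 0) ^+ 2 + (v 1 0 - p 1 0) ^+ 2 + (v ord_max 0 - p ord_max 0) ^+ 2.
Proof. exact: sum3. Qed.

Lemma vec3P v p : v 0 0 = p 0 0 -> v 1 0 = p 1 0 -> v ord_max 0 = p ord_max 0 -> v = p.
Proof.
move=> v0 v1 v2; apply/colP => -[[|[|[|//]]] H].
- by rewrite (_ : Ordinal H = 0) //; apply/val_inj.
- by rewrite (_ : Ordinal H = 1) //; apply/val_inj.
- by rewrite (_ : Ordinal H = ord_max) //; apply/val_inj.
Qed.

Lemma ASO2_mapE (a : 'M[R]_(2, 2 + 1)) (v : 'cV[R]_(2 + 1)) :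
  ASO2_map a v = col_mx (lsubmx a *m usubmx v + rsubmx a) (dsubmx v).
Proof.
rewrite /ASO2_map -[in LHS](vsubmxK v) mul_block_col add_col_mx.
by rewrite mul0mx addr0 mul0mx add0r mul1mx addr0.
Qed.

Lemma polynomial_fun_ASO2_map (v : 'cV[R]_3) k :
  polynomial_fun (fun a => ASO2_map (vec_mx a) v k 0).
Proof.
under [X in polynomial_fun X]funext do rewrite ASO2_mapE.
case: (split_ordP k) => {}k ->; last first.
  under [X in polynomial_fun X]funext do rewrite col_mxEd.
  exact: polynomial_fun_cst.
under [X in polynomial_fun X]funext => a.
  rewrite col_mxEu mxE [rsubmx _ _ _]mxE mxE.
  under eq_bigr do rewrite [lsubmx _ _ _]mxE.
  over.
apply: polynomial_funD; last exact: polynomial_fun_vec_mx.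
apply: polynomial_fun_sum => j; apply: polynomial_funM; last exact: polynomial_fun_cst.
exact: polynomial_fun_vec_mx.
Qed.

Lemma polynomial_fun_sqdist_ASO2_map p v :
  polynomial_fun (fun a => sqdist p (ASO2_map (vec_mx a) v)).
Proof.
apply: polynomial_fun_sum => k; apply: polynomial_funX; apply: polynomial_funB.
  exact: polynomial_fun_cst.
exact: polynomial_fun_ASO2_map.
Qed.

Lemma ASO2_map_vehicle c s x y v :
  [/\ ASO2_map (vehicle c s x y) v 0 0 = c * v 0 0 - s * v 1 0 + x,
      ASO2_map (vehicle c s x y) v 1 0 = s * v 0 0 + c * v 1 0 + y &
      ASO2_map (vehicle c s x y) v ord_max 0 = v ord_max 0].
Proof.
have e0 : 0 = lshift 1 0 :> 'I_(2 + 1) by apply/val_inj.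
have e1 : 1 = lshift 1 1 :> 'I_(2 + 1) by apply/val_inj.
have e2 : ord_max = rshift 2 0 :> 'I_(2 + 1) by apply/val_inj.
have l1 : lift 0 0 = 1 :> 'I_2 by apply/val_inj.
rewrite ASO2_mapE /vehicle row_mxKl row_mxKr e0 e1 e2 !col_mxEu col_mxEd.
rewrite !mxE !big_ord_recl !big_ord0 l1 !mxE /=.
by split; rewrite ?addr0 ?mulNr.
Qed.

(** The inverse motion applied to p: distances to moved microphones become distances to the initial
    ones. *)
Definition vehicle_coordinates c s x y p : 'cV[R]_3 :=
  \col_k [:: c * (p 0 0 - x) + s * (p 1 0 - y); c * (p 1 0 - y) - s * (p 0 0 - x);
             p ord_max 0]`_k.

Lemma sqdist_vehicle c s x y p v : c ^+ 2 + s ^+ 2 = 1 ->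
  sqdist p (ASO2_map (vehicle c s x y) v) = sqdist (vehicle_coordinates c s x y p) v.
Proof.
move=> cs; rewrite !sqdistE; have [-> -> ->] := ASO2_map_vehicle c s x y v.
rewrite !mxE /=; apply/eqP; rewrite -subr_eq0; apply/eqP.
transitivity ((c ^+ 2 + s ^+ 2 - 1) *
  (v 0 0 ^+ 2 + v 1 0 ^+ 2 - (p 0 0 - x) ^+ 2 - (p 1 0 - y) ^+ 2)); first by ring.
by rewrite cs subrr mul0r.
Qed.

Lemma vehicle_coordinatesK c s x y p : c ^+ 2 + s ^+ 2 = 1 ->
  ASO2_map (vehicle c s x y) (vehicle_coordinates c s x y p) = p.
Proof.
move=> cs; have [e0 e1 e2] := ASO2_map_vehicle c s x y (vehicle_coordinates c s x y p).
apply: vec3P; rewrite ?e0 ?e1 ?e2 !mxE //=; apply/eqP; rewrite -subr_eq0; apply/eqP.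
  by transitivity ((c ^+ 2 + s ^+ 2 - 1) * (p 0 0 - x)); [ring | rewrite cs subrr mul0r].
by transitivity ((c ^+ 2 + s ^+ 2 - 1) * (p 1 0 - y)); [ring | rewrite cs subrr mul0r].
Qed.

End VehicleFrame.

Section CayleyMenger.
Variable R : realType.
Implicit Types (p q s : 'cV[R]_3).

Lemma det_mulmx_eq0 (F : fieldType) n r (U : 'M[F]_(n, r)) (V : 'M[F]_(r, n)) :
  (r < n)%N -> \det (U *m V) = 0.
Proof.
move=> rn; apply/eqP; apply: contraTT rn; rewrite -unitfE -[_ \is a _]/(U *m V \in unitmx).
move=> /mxrank_unit rUV; rewrite -leqNgt -{1}rUV.
exact: leq_trans (mxrankM_maxl _ _) (rank_leq_col _).
Qed.

(* The bordered distance matrix has rank at most 5: its entries are the products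
   [(|p|^2, p, 1) (1, -2 q, |q|^2)^T], with [(1, 0, 0)] and [(0, 0, 1)^T] for the
   border. *)
Lemma f_D_eq0 (m : 'I_4 -> 'cV[R]_3) s : f_D m (fun i => sqdist s (m i)) = 0.
Proof.
pose u p : 'rV[R]_5 := \row_k [:: dot p p; p 0 0; p 1 0; p ord_max 0; 1]`_k.
pose v q : 'cV[R]_5 :=
  \col_k [:: 1; - 2 * q 0 0; - 2 * q 1 0; - 2 * q ord_max 0; dot q q]`_k.
have uv p q : \sum_k u p 0 k * v q k 0 = sqdist p q.
  under eq_bigr do rewrite !mxE.
  rewrite !big_ord_recl big_ord0 /= sqdistE /dot !sum3; ring.
have uv' p q : sqdist p q = sqdist q p by rewrite !sqdistE; ring.
pose U := col_mx (u s) (col_mx (\matrix_(i < 4) u (m i)) (delta_mx 0 0 : 'M_(1, 5))).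
pose V := row_mx (v s) (row_mx (\matrix_(k, i) v (m i) k 0) (delta_mx ord_max 0 : 'M_(5, 1))).
suff -> : f_D m (fun i => sqdist s (m i)) = \det (U *m V) by apply: det_mulmx_eq0.
rewrite /f_D; congr (\det _).
rewrite /U /V mul_col_row mul_mx_row mul_col_mx mul_col_row tr_row_mx.
have vmax q : v q 0 0 = 1 by rewrite mxE.
have umax p : u p 0 ord_max = 1 by rewrite mxE.
have row_max (w : 'rV[R]_5) j : (w *m (delta_mx ord_max 0 : 'M_(5, 1))) 0 j = w 0 ord_max.
  by rewrite ord1 -colE mxE.
have max_col (w : 'cV[R]_5) j : ((delta_mx 0 0 : 'M_(1, 5)) *m w) j 0 = w 0 0.
  by rewrite ord1 -rowE mxE.
congr block_mx.
- by apply/matrixP => i j; rewrite !ord1 [RHS]mxE uv mxE sqdistE !subrr expr0n /= !addr0.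
- congr row_mx; apply/matrixP => i j; rewrite !ord1; last by rewrite row_max umax mxE.
  by rewrite !mxE -uv; apply: eq_bigr => k _; rewrite !mxE.
- congr col_mx; apply/matrixP => i j; rewrite !ord1; last by rewrite max_col vmax !mxE.
  by rewrite !mxE uv' -uv; apply: eq_bigr => k _; rewrite !mxE.
- congr block_mx; apply/matrixP => i j.
  + by rewrite !mxE -uv; apply: eq_bigr => k _; rewrite !mxE.
  + by rewrite ord1 -colE !mxE.
  + by rewrite ord1 -rowE !mxE.
  + by rewrite !ord1 -rowE !mxE.
Qed.

End CayleyMenger.

(** * Tuples compatible with every position *)

Section Microphones.
Variables (R : realType) (m : 'I_4 -> 'cV[R]_3).
Hypothesis hm : ~ coplanar m.
Implicit Types (s t : 'cV[R]_3) (tau : 'I_4 -> 'cV[R]_3) (d : 'I_4 -> R).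

(** A nonzero linear part would define a plane through all four microphones. This allows
    coefficients to be compared in identities that are affine in the microphone coordinates. *)
Lemma affine_form_eq0 (k a b c : R) :
  (forall i, k + a * m i 0 0 + b * m i 1 0 + c * m i ord_max 0 = 0) ->
  [/\ k = 0, a = 0, b = 0 & c = 0].
Proof.
move=> H; pose u : 'cV[R]_3 := \col_j [:: a; b; c]`_j.
have uE v : dot u v = a * v 0 0 + b * v 1 0 + c * v ord_max 0.
  by rewrite /dot sum3 !mxE.
have u0 : u = 0.
  apply: contrapT => /eqP u0; apply: hm; exists [set v | dot u v = - k].
    by exists u, (- k).
  by move=> i; rewrite /= uE; have := H i; lra.
have a0 : a = 0 by have /matrixP/(_ 0 0) := u0; rewrite !mxE.
have b0 : b = 0 by have /matrixP/(_ 1 0) := u0; rewrite !mxE.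
have c0 : c = 0 by have /matrixP/(_ ord_max 0) := u0; rewrite !mxE.
by split => //; have := H 0; rewrite a0 b0 c0; lra.
Qed.

(** The difference of the two squared distances is affine in [m i], with linear part 2 (t - s). *)
Lemma equidistant_unique s t : (forall i, sqdist s (m i) = sqdist t (m i)) -> s = t.
Proof.
move=> st.
have [_ H0 H1 H2] : [/\ sqdist s 0 - sqdist t 0 = 0, 2 * (t 0 0 - s 0 0) = 0,
    2 * (t 1 0 - s 1 0) = 0 & 2 * (t ord_max 0 - s ord_max 0) = 0].
  apply: affine_form_eq0 => i; rewrite !sqdistE !mxE.
  by have := st i; rewrite !sqdistE => /eqP; rewrite -subr_eq0 => /eqP H; rewrite -[RHS]H; ring.
by apply: vec3P; [move: H0|move: H1|move: H2]; lra.
Qed.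

Lemma equidistant_unique_vehicle (a : 'M[R]_(2, 2 + 1)) s t : is_ASO2 a ->
  (forall i, sqdist s (ASO2_map a (m i)) = sqdist t (ASO2_map a (m i))) -> s = t.
Proof.
move=> /is_ASO2_vehicleP[c [e [x [y [ce ->]]]]] st.
rewrite -(vehicle_coordinatesK x y s ce) -(vehicle_coordinatesK x y t ce).
congr ASO2_map; apply: equidistant_unique => i.
by rewrite -!sqdist_vehicle.
Qed.

(** Column i is (1, -2 m_i), so that (|t|^2, t) is sent to the values |t - m_i|^2 - |m_i|^2. *)
Let G : 'M[R]_(1 + 3, 4) := col_mx (const_mx 1) (\matrix_(k, i) (- 2 * m i k 0)).

Let mulmxG (w : 'rV[R]_(1 + 3)) i : (w *m G) 0 i =
  w 0 (lshift 3 0) - 2 * dot (rsubmx w)^T (m i).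
Proof.
rewrite -[in LHS](hsubmxK w) mul_row_col mxE [(lsubmx w *m _) _ _]mxE big_ord1 !mxE mulr1.
congr (_ + _); rewrite /dot mulr_sumr -sumrN; apply: eq_bigr => k _.
by rewrite !mxE; ring.
Qed.

(** A vector of the left kernel is an affine form vanishing at the four microphones. *)
Let G_unit : (G : 'M_4) \in unitmx.
Proof.
rewrite -row_free_unit -kermx_eq0; apply/rowV0P.
suff G_inj (w : 'rV[R]_(1 + 3)) : w *m G = 0 -> w = 0 by move=> w /sub_kermxP/G_inj.
move=> wG; have wE := mulmxG w; set t := (rsubmx w)^T in wE.
have [w0 t0 t1 t2] : [/\ w 0 (lshift 3 0) = 0, - 2 * t 0 0 = 0, - 2 * t 1 0 = 0 &
    - 2 * t ord_max 0 = 0].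
  apply: affine_form_eq0 => i; have := wE i; rewrite wG mxE /dot sum3 => H.
  by rewrite [RHS]H; ring.
have t_eq0 : t = 0 by apply: vec3P; rewrite [RHS]mxE; lra.
rewrite -(hsubmxK w) -[rsubmx w]trmxK -/t t_eq0 trmx0.
have -> : lsubmx w = 0 by apply/matrixP => i j; rewrite !ord1 !mxE.
exact: row_mx0.
Qed.

(* The equations [|t - m i|^2 = d i] are linear in [(|t|^2, t)]; this solves them
   and measures the failure of the compatibility of the two components. *)
Definition compatibility d : R :=
  let w : 'rV[R]_(1 + 3) := (\row_i (d i - dot (m i) (m i))) *m invmx (G : 'M_4) in
  w 0 (lshift 3 0) - \sum_(k < 3) w 0 (rshift 1 k) ^+ 2.

Lemma compatibilityP d :
  compatibility d = 0 <-> exists t, forall i, sqdist t (m i) = d i.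
Proof.
have sqE t i : sqdist t (m i) = dot t t - 2 * dot t (m i) + dot (m i) (m i).
  by rewrite sqdistE /dot !sum3; ring.
rewrite /compatibility; set D := \row_i _; split => [c0|[t td]].
  pose w : 'rV[R]_(1 + 3) := D *m invmx (G : 'M_4).
  have wG : w *m G = D by exact: (mulmxKV G_unit).
  exists (rsubmx w)^T => i; rewrite sqE.
  have /rowP/(_ i) := wG; rewrite mulmxG [D _ _]mxE => wi.
  have -> : dot (rsubmx w)^T (rsubmx w)^T = w 0 (lshift 3 0).
    apply/eqP; rewrite eq_sym -subr_eq0 -[X in _ == X]c0; apply/eqP.
    by congr (_ - _); apply: eq_bigr => k _; rewrite !mxE expr2.
  by rewrite wi subrK.
pose w : 'rV[R]_(1 + 3) := row_mx (dot t t)%:M t^T.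
have wG : w *m G = D.
  apply/rowP => i; rewrite mulmxG [RHS]mxE -td sqE /w row_mxKr trmxK row_mxEl mxE mulr1n.
  by rewrite addrK.
have -> : D *m invmx (G : 'M_4) = w by rewrite -wG; exact: (mulmxK G_unit).
rewrite /w row_mxEl mxE mulr1n; apply/eqP; rewrite subr_eq0; apply/eqP.
by apply: eq_bigr => k _; rewrite row_mxEr mxE expr2.
Qed.

Lemma polynomial_fun_compatibility N (d : 'rV[R]_N -> 'I_4 -> R) :
  (forall i, polynomial_fun (fun x => d x i)) ->
  polynomial_fun (fun x => compatibility (d x)).
Proof.
move=> dP.
have wP j : polynomial_fun (fun x => (\row_i (d x i - dot (m i) (m i)) *m invmx (G : 'M_4)) 0 j).
  under [X in polynomial_fun X]funext do rewrite mxE.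
  apply: polynomial_fun_sum => i; apply: polynomial_funM; last exact: polynomial_fun_cst.
  under [X in polynomial_fun X]funext do rewrite mxE.
  by apply: polynomial_funB => //; apply: polynomial_fun_cst.
apply: polynomial_funB; first exact: wP.
apply: polynomial_fun_sum => k; apply: polynomial_funX; exact: wP.
Qed.

(** Here t is the suggested point in the vehicle frame, hence its comparison with the unmoved
    microphones. *)
Definition deceived_everywhere tau := forall c e x y : R, c ^+ 2 + e ^+ 2 = 1 ->
  exists t, forall i, sqdist t (m i) = sqdist (tau i) (ASO2_map (vehicle c e x y) (m i)).

(* Compares the positions with translation parts [b], [-b] and [0] and rotation
   parts [1] and [-1]. *)
Lemma deceived_horizontal tau (x y : R) : deceived_everywhere tau ->
  exists k, forall i, tau i 0 0 * x + tau i 1 0 * y = k.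
Proof.
move=> tauP.
have half (e : R) : e ^+ 2 = 1 -> exists k t0 t1 t2 : R,
   [/\ t0 ^+ 2 + t1 ^+ 2 + t2 ^+ 2 = x ^+ 2 + y ^+ 2 &
    forall i, k - 2 * (t0 * m i 0 0 + t1 * m i 1 0 + t2 * m i ord_max 0) =
      - 2 * (tau i 0 0 * x + tau i 1 0 * y) + 2 * e * (m i 0 0 * x + m i 1 0 * y)].
  move=> e1; have e2 : e ^+ 2 + 0 ^+ 2 = 1 by rewrite e1 expr0n addr0.
  have [u uE] := tauP e 0 0 0 e2; have [v vE] := tauP e 0 x y e2.
  have [w wE] := tauP e 0 (- x) (- y) e2.
  have E t x' y' i : sqdist t (m i) = sqdist (tau i) (ASO2_map (vehicle e 0 x' y') (m i)) ->
    t 0 0 ^+ 2 + t 1 0 ^+ 2 + t ord_max 0 ^+ 2 -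
      2 * (t 0 0 * m i 0 0 + t 1 0 * m i 1 0 + t ord_max 0 * m i ord_max 0) =
    dot (tau i) (tau i) + x' ^+ 2 + y' ^+ 2 - 2 * (tau i 0 0 * x' + tau i 1 0 * y')
    - 2 * e * (tau i 0 0 * m i 0 0 + tau i 1 0 * m i 1 0)
    - 2 * tau i ord_max 0 * m i ord_max 0 + 2 * e * (m i 0 0 * x' + m i 1 0 * y').
    rewrite !sqdistE; have [-> -> ->] := ASO2_map_vehicle e 0 x' y' (m i).
    rewrite /dot sum3 => /eqP; rewrite -subr_eq0 => /eqP H.
    apply/eqP; rewrite -subr_eq0 -[X in _ == X]H; apply/eqP.
    apply/eqP; rewrite -subr_eq0; apply/eqP.
    transitivity ((e ^+ 2 - 1) * (m i 0 0 ^+ 2 + m i 1 0 ^+ 2)); first by ring.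
    by rewrite e1 subrr mul0r.
  have {}uE i := E _ _ _ i (uE i); have {}vE i := E _ _ _ i (vE i).
  have {E wE} wE i := E _ _ _ i (wE i).
  set nu := u 0 0 ^+ 2 + _ + _ in uE; set nv := v 0 0 ^+ 2 + _ + _ in vE.
  set nw := w 0 0 ^+ 2 + _ + _ in wE.
  (* Taking second differences in the position gives v + w = 2 u, and the quadratic parts then give
     |v - u|^2 = x^2 + y^2. *)
  have [H H0 H1 H2] : [/\ nv + nw - 2 * nu - 2 * (x ^+ 2 + y ^+ 2) = 0,
     - 2 * (v 0 0 + w 0 0 - 2 * u 0 0) = 0, - 2 * (v 1 0 + w 1 0 - 2 * u 1 0) = 0 &
     - 2 * (v ord_max 0 + w ord_max 0 - 2 * u ord_max 0) = 0].
    by apply: affine_form_eq0 => i; have := uE i; have := vE i; have := wE i; lra.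
  exists (nv - nu - (x ^+ 2 + y ^+ 2)), (v 0 0 - u 0 0), (v 1 0 - u 1 0),
    (v ord_max 0 - u ord_max 0).
  split; last by move=> i; have := uE i; have := vE i; lra.
  have w0 : w 0 0 = 2 * u 0 0 - v 0 0 by lra.
  have w1 : w 1 0 = 2 * u 1 0 - v 1 0 by lra.
  have w2 : w ord_max 0 = 2 * u ord_max 0 - v ord_max 0 by lra.
  by move: H; rewrite /nv /nw /nu w0 w1 w2; lra.
have [|k1 [p0 [p1 [p2 [np pE]]]]] := half 1; first by rewrite expr1n.
have [|k2 [q0 [q1 [q2 [nq qE]]]]] := half (-1); first by rewrite sqrrN expr1n.
have [_ H0 H1 H2] : [/\ k1 - k2 = 0, - 2 * (p0 - q0) - 4 * x = 0,
    - 2 * (p1 - q1) - 4 * y = 0 & - 2 * (p2 - q2) = 0].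
  by apply: affine_form_eq0 => i; have := pE i; have := qE i; lra.
have p0E : p0 = q0 - 2 * x by lra.
have p1E : p1 = q1 - 2 * y by lra.
have p2E : p2 = q2 by lra.
(* With b = (x, y, 0), the relations p = q - 2 b and |p| = |q| = |b| force q = b and p = -b. *)
have : (q0 - x) ^+ 2 + ((q1 - y) ^+ 2 + q2 ^+ 2) = 0.
  by move: np; rewrite p0E p1E p2E; lra.
move/eqP; rewrite !paddr_eq0 ?addr_ge0 ?sqr_ge0 // !sqrf_eq0.
move=> /and3P[/eqP q0E /eqP q1E /eqP q2E].
exists (- k1 / 2) => i; have := pE i.
have -> : p0 = - x by lra.
have -> : p1 = - y by lra.
have -> : p2 = 0 by lra.
lra.
Qed.

Lemma deceived_shape tau : deceived_everywhere tau ->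
  exists x y w, forall i, [/\ tau i 0 0 = x, tau i 1 0 = y &
    (tau i ord_max 0 - w) * (tau i ord_max 0 + w - 2 * m i ord_max 0) = 0].
Proof.
move=> tauP.
have [x tau_x] := deceived_horizontal 1 0 tauP.
have [y tau_y] := deceived_horizontal 0 1 tauP.
have {}tau_x i : tau i 0 0 = x by have := tau_x i; rewrite mulr1 mulr0 addr0.
have {}tau_y i : tau i 1 0 = y by have := tau_y i; rewrite mulr1 mulr0 add0r.
have one0 : (1 : R) ^+ 2 + 0 ^+ 2 = 1 by rewrite expr1n expr0n addr0.
(* The vehicle is placed without rotation at offset (p, q) from the common vertical line. *)
have shifted (p q : R) : exists t, forall i,
    t 0 0 ^+ 2 + t 1 0 ^+ 2 + t ord_max 0 ^+ 2 -
      2 * (t 0 0 * m i 0 0 + t 1 0 * m i 1 0 + t ord_max 0 * m i ord_max 0) =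
    p ^+ 2 + q ^+ 2 + 2 * p * m i 0 0 + 2 * q * m i 1 0 +
    tau i ord_max 0 ^+ 2 - 2 * tau i ord_max 0 * m i ord_max 0.
  have [t tE] := tauP 1 0 (x + p) (y + q) one0; exists t => i; have := tE i.
  rewrite !sqdistE; have [-> -> ->] := ASO2_map_vehicle 1 0 (x + p) (y + q) (m i).
  rewrite tau_x tau_y; lra.
have [u uE] := shifted 0 0.
(* Comparing coefficients gives v = u - (p, q, 0) and |v|^2 = |u|^2 + p^2 + q^2, so u is orthogonal
   to (p, q, 0). *)
have u_dir (p q : R) : p * u 0 0 + q * u 1 0 = 0.
  have [v vE] := shifted p q.
  set nu := u 0 0 ^+ 2 + _ + _ in uE; set nv := v 0 0 ^+ 2 + _ + _ in vE.
  have [H H0 H1 H2] : [/\ nv - nu - p ^+ 2 - q ^+ 2 = 0, - 2 * (v 0 0 - u 0 0 + p) = 0,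
      - 2 * (v 1 0 - u 1 0 + q) = 0 & - 2 * (v ord_max 0 - u ord_max 0) = 0].
    by apply: affine_form_eq0 => i; have := uE i; have := vE i; lra.
  have v0 : v 0 0 = u 0 0 - p by lra.
  have v1 : v 1 0 = u 1 0 - q by lra.
  have v2 : v ord_max 0 = u ord_max 0 by lra.
  by move: H; rewrite /nv /nu v0 v1 v2; lra.
have u0 : u 0 0 = 0 by have := u_dir 1 0; lra.
have u1 : u 1 0 = 0 by have := u_dir 0 1; lra.
exists x, y, (u ord_max 0) => i; split => //.
by have := uE i; rewrite u0 u1; lra.
Qed.

Lemma deceived_everywhereP tau : deceived_everywhere tau ->
  ~ unlucky_stack m (range tau) ->
  exists i, forall a s, is_ASO2 a ->
    (forall j, sqdist s (ASO2_map a (m j)) = sqdist (tau j) (ASO2_map a (m j))) ->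
    s = tau i.
Proof.
move=> /deceived_shape[x [y [w tauE]]] lucky.
have [[i iw]|/forallNP nw] := pselect (exists i, tau i ord_max 0 = w); last first.
  case: lucky; exists tau; split; first by move=> i; exists i.
    by exists x, y => i; have [] := tauE i.
  have tauz i : tau i ord_max 0 = 2 * m i ord_max 0 - w.
    have [_ _ /eqP] := tauE i; rewrite mulf_eq0 => /orP[/eqP H|/eqP H]; last by lra.
    by case: (nw i); lra.
  by move=> i j; rewrite /zcoord !mxE !tauz; lra.
(* On the common vertical line, [tau j] is at height w or at its mirror image 2 zeta_j - w about the
   height of microphone j, so it is as far from that microphone as [tau i]. *)
exists i => a s aP sE; apply: (equidistant_unique_vehicle aP) => j; rewrite {}sE.
have [c [e [p [q [_ ->]]]]] := is_ASO2_vehicleP aP.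
rewrite !sqdistE; have [-> -> ->] := ASO2_map_vehicle c e p q (m j).
have [-> -> jw] := tauE j; have [-> -> _] := tauE i; rewrite iw.
by move: jw; lra.
Qed.

End Microphones.

(** * Bad positions *)

Section GoodPositions.
Variables (R : realType) (m : 'I_4 -> 'cV[R]_3) (L : 'cV[R]_3).
Hypothesis hm : ~ coplanar m.

(** The true distances of a wall heard by all microphones pass the determinant test, so a position
    can fail to be good only through a ghost. *)
Lemma heard_wall_detected (m' : 'I_4 -> 'cV[R]_3) (H : 'I_4 -> set (set 'cV[R]_3)) P :
  (forall i, H i P) -> detected m' L H (reflection P L).
Proof.
move=> HP; exists (fun i => sqdist (reflection P L) (m' i)); split => //.
  by move=> i; exists P.
exact: f_D_eq0.
Qed.

Lemma bad_positions_dim_lt n (W : set (set 'cV[R]_3))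
    (H : 'M[R]_(2, 2 + 1) -> 'I_4 -> set (set 'cV[R]_3)) :
  (W #= `I_n)%card ->
  (forall a, is_ASO2 a -> forall i, H a i `<=` W) ->
  ~ unlucky_stack m [set reflection P L | P in W] ->
  exists X : set 'rV[R]_(2 * (2 + 1)),
    [/\ zariski_closed X, X `<=` ASO2_variety R, dim_lt X 3 &
        forall a, is_ASO2 a ->
          ~ good_position (fun i => ASO2_map a (m i)) L W (H a) ->
          X (mxvec a)].
Proof.
rewrite card_eq_sym => /card_set_bijP[w [w_in _ w_surj]] HW lucky.
pose tau (f : {ffun 'I_4 -> 'I_n}) i := reflection (w (f i)) L.
pose data f (x : 'rV[R]_(2 * (2 + 1))) i := sqdist (tau f i) (ASO2_map (vec_mx x) (m i)).
pose F f := [set x | compatibility m (data f x) = 0].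
have cF f : zariski_closed (F f).
  apply/zariski_closed_eq0/polynomial_fun_compatibility => i.
  exact: polynomial_fun_sqdist_ASO2_map.
(* Only tuples whose compatibility condition is not identically satisfied contribute to the
   exceptional set. *)
pose P f := ~ (ASO2_variety R `<=` F f).
exists (ASO2_variety R `&` [set x | exists2 f, P f & F f x]); split.
- by apply: zariski_closedI; [exact: zariski_closed_ASO2 | exact: zariski_closed_bigcup].
- by move=> x [].
- apply: (irreducible_proper_dim_lt (@irreducible_ASO2 R) (@has_dim_ASO2 R)); first by move=> x [].
  (* If the exceptional set were everything, irreducibility would put ASO(2) inside one [F f],
     against [P f]. *)
  move=> sub; have [|f] := irreducible_bigcup (P := P) (@irreducible_ASO2 R) cF.
    by move=> x /sub[].
  by [].
move=> a aP bad; split; first by exists a.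
have [s [[d [dE _ sd]] s_new]] : exists s, ghost (fun i => ASO2_map a (m i)) L W (H a) s.
  apply: contrapT => no_ghost; apply: bad; split => // P' HP'.
  exact: heard_wall_detected.
(* Each distance used by the ghost is that of some wall, which determines the tuple. *)
have /choice[f fE] i : exists k : 'I_n, sqdist (reflection (w k) L) (ASO2_map a (m i)) = d i.
  have [P' /(HW a aP i)/w_surj[k kn <-] P'd] := dE i.
  by exists (Ordinal kn).
pose g := [ffun i => f i].
have sE i : sqdist s (ASO2_map a (m i)) = sqdist (tau g i) (ASO2_map a (m i)).
  by rewrite sd /tau ffunE fE.
exists g; last first.
  apply/(compatibilityP hm); have [c [e [x [y [ce aE]]]]] := is_ASO2_vehicleP aP.
  exists (vehicle_coordinates c e x y s) => i.
  by rewrite -sqdist_vehicle // -aE sE /data mxvecK.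
(* Were the condition satisfied at every position, the tuple would be deceived everywhere and the
   ghost would be one of its true mirror points. *)
move=> sub; apply: s_new.
have [||i iE] := deceived_everywhereP hm (tau := tau g).
- move=> c e x y ce; have aso := is_ASO2_vehicle x y ce.
  have /sub/(compatibilityP hm)[t tE] : ASO2_variety R (mxvec (vehicle c e x y)).
    by exists (vehicle c e x y).
  by exists t => i; rewrite tE /data mxvecK.
- move=> [t [t_in t_line t_z]]; apply: lucky; exists t; split => // i.
  have [j _ <-] := t_in i; exists (w (g j)) => //.
  exact: w_in (ltn_ord _).
exists (w (g i)); first exact: w_in (ltn_ord _).
exact: iE sE.
Qed.

End GoodPositions.

Theorem theorem3p1 (R : realType) (m : 'I_4 -> 'cV[R]_3) (L : 'cV[R]_3)
    (n : nat) (hm : ~ coplanar m) :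
  has_dim (ASO2_variety R) 3 /\
  (forall (W : set (set 'cV[R]_3))
          (H : 'M[R]_(2, 2 + 1) -> 'I_4 -> set (set 'cV[R]_3)),
     (W #= `I_n)%card ->
     (forall P, W P -> is_plane P) ->
     (forall a, is_ASO2 a -> forall i, H a i `<=` W) ->
     ~ unlucky_stack m [set reflection P L | P in W] ->
     exists X : set 'rV[R]_(2 * (2 + 1)),
       [/\ zariski_closed X, X `<=` ASO2_variety R, dim_lt X 3 &
           forall a, is_ASO2 a ->
             ~ good_position (fun i => ASO2_map a (m i)) L W (H a) ->
             X (mxvec a)]) /\
  (let l := num_zcoords m in
   let unlucky := [set c : 'M[R]_(3, n) | unlucky_stack m (range (fun k : 'I_n => col k c))] in
   [/\ (2 <= l <= 4)%N,
       (n < l)%N -> unlucky = set0 &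
       (l <= n)%N ->
       exists X : set 'rV[R]_(3 * n),
         [/\ zariski_closed X, has_codim X (3 * (l - 1)) &
             mxvec @` unlucky `<=` X]]).
Proof.
split; first exact: has_dim_ASO2.
split; last exact: unlucky_arrangements_codim.
by move=> W H Wn _ HW lucky; apply: (bad_positions_dim_lt hm Wn HW lucky).
Qed.
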